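(* For every integer $n\ge 1$, the Chow polynomial of the noncrossing partition lattice $\mathrm{NC}_{n+1}$ equals the descent generating function of tieless parking functions of length $n$: $$H_{\mathrm{NC}_{n+1}}(x)=\sum_{\rho\in \mathrm{NT}_n} x^{\mathrm{des}(\rho)}.$$
   Context: Notation: $[n]=\{1,\dots,n\}$. Chow polynomial. Let $P$ be a finite, graded, bounded poset with rank function $\mathrm{rk}$, minimum $\hat 0$ and maximum $\hat 1$. Its Chow polynomial is $$H_P(x)=\sum_{\hat 0=p_0<p_1<\cdots<p_m\le \hat 1}\ \prod_{i=1}^m x\,[\mathrm{rk}(p_i)-\mathrm{rk}(p_{i-1})-1]_x\in\mathbb{R}[x],$$ where the sum is over all chains of $P$ (with $m\ge 0$ arbitrary) starting at $\hat 0$, and $[k]_x=1+x+\cdots+x^{k-1}$ for $k\ge 0$ (so $[0]_x=0$; the empty product is $1$). Noncrossing partition lattice. Let $v_1,\dots,v_{n+1}$ be the vertices of a regular $(n+1)$-gon inscribed in the unit circle, labeled clockwise. A set partition $\pi$ of $[n+1]$ is noncrossing if for any two distinct blocks $A,B$ of $\pi$, the convex hulls of $\{v_a:a\in A\}$ and $\{v_b:b\in B\}$ do not intersect. $\mathrm{NC}_{n+1}$ is the poset of noncrossing partitions of $[n+1]$ ordered by refinement (finer partitions are smaller). It is a graded bounded lattice, with the rank of $\pi$ equal to $n+1-|\pi|$, where $|\pi|$ is the number of blocks of $\pi$. Parking functions. A parking function of length $n$ is a function $\rho:[n]\to[n]$, identified with the tuple $(\rho_1,\dots,\rho_n)$,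 such that $\#\rho^{-1}([k])\ge k$ for all $1\le k\le n$ (equivalently, the weakly increasing rearrangement $\tilde\rho$ satisfies $\tilde\rho_i\le i$ for all $i$). $\mathrm{PF}_n$ is the set of these. $\mathrm{des}(\rho)$ is the number of $i\in[n-1]$ with $\rho_i>\rho_{i+1}$. $\rho$ is tieless if $\rho_i\ne\rho_{i+1}$ for all $i\in[n-1]$; $\mathrm{NT}_n$ is the set of tieless parking functions of length $n$. *)

(* Defs.v *)
From HB Require Import structures.
From mathcomp Require Import all_boot all_order all_algebra.
From mathcomp Require Import boolp classical_sets reals convex trigo.
From mathcomp Require Import ring.

Set Implicit Arguments.
Unset Strict Implicit.
Unset Printing Implicit Defensive.

Import Order.TTheory GRing.Theory Num.Theory.
Local Open Scope ring_scope.

Section ChowPolynomial.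
Context (R : nzRingType) (d : Order.disp_t) (P : finTBPOrderType d).

Definition qint (k : nat) : {poly R} := \sum_(i < k) 'X^i.

(* A chain \bot = p_0 < p_1 < ... < p_m is encoded by the m-tuple
   t = (p_1, ..., p_m); a chain in P has at most #|P| elements, so m < #|P|.
   The factor with index i below is the one attached to p_i < p_(i+1).
   rk is meant to be the rank function of a graded P. *)
Definition chow_poly (rk : P -> nat) : {poly R} :=
  \sum_(m < #|P|) \sum_(t : m.-tuple P | path <%O \bot%O t)
    \prod_(i < m)
      ('X * qint (rk (tnth t i) - rk (nth \bot%O (\bot%O :: t) i) - 1)).

End ChowPolynomial.

Section NoncrossingPartitions.
Context (R : realType).

(* The index i : 'I_N stands for the label i + 1; labels run clockwise. *)
Definition polygon_vertex (N : nat) (i : 'I_N) : 'rV[R]_2 :=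
  let theta := 2 * pi * i%:R / N%:R in
  \row_(j < 2) (if j == 0 then cos theta else - sin theta).

Definition vertex_hull (N : nat) (A : {set 'I_N}) : set 'rV[R]_2 :=
  smallest (@convex_set R _) [set polygon_vertex i | i in [set` A]]%classic.

Definition noncrossing (N : nat) (pi : {set {set 'I_N}}) : Prop :=
  forall A B, A \in pi -> B \in pi -> A != B ->
    (vertex_hull A `&` vertex_hull B = set0)%classic.

Record NC (N : nat) := MkNC {
  nc_blocks :> {set {set 'I_N}};
  _ : finset.partition nc_blocks [set: 'I_N] && `[< noncrossing nc_blocks >] }.

HB.instance Definition _ N := [isSub for @nc_blocks N].
HB.instance Definition _ N := [Finite of NC N by <:].

Lemma nc_partition N (p : NC N) : finset.partition p [set: 'I_N].
Proof. by case: p => p /= /andP[]. Qed.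

Definition nc_le N (p q : NC N) : bool :=
  [forall A in nc_blocks p, exists B in nc_blocks q, A \subset B].

Lemma nc_leP N (p q : NC N) :
  reflect (forall A, A \in nc_blocks p ->
             exists2 B, B \in nc_blocks q & A \subset B) (nc_le p q).
Proof.
by apply: (iffP forall_inP) => h A /h => [/exists_inP | hA]; last exact/exists_inP.
Qed.

Lemma nc_le_refl N : reflexive (@nc_le N).
Proof. by move=> p; apply/nc_leP => A Ap; exists A. Qed.

Lemma nc_le_trans N : transitive (@nc_le N).
Proof.
move=> q p r /nc_leP pq /nc_leP qr; apply/nc_leP => A /pq [B /qr [C Cr BC] AB].
by exists C => //; apply: fintype.subset_trans BC.
Qed.

Lemma nc_le_sub N (p q : NC N) : nc_le p q -> nc_le q p ->
  nc_blocks p \subset nc_blocks q.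
Proof.
move=> /nc_leP pq /nc_leP qp; apply/fintype.subsetP => A Ap.
have /and3P[_ /finset.trivIsetP tr p0] := nc_partition p.
have [B Bq AB] := pq _ Ap; have [C Cp BC] := qp _ Bq.
have AC : A = C.
  apply/eqP/negP => /negP AC; have := tr _ _ Ap Cp AC.
  rewrite finset.disjoints_subset => AC0.
  have /finset.set0Pn[x xA] : A != finset.set0 by apply: contraNneq p0 => <-.
  have := fintype.subsetP AC0 _ xA; rewrite inE.
  by rewrite (fintype.subsetP (fintype.subset_trans AB BC) _ xA).
suff -> : A = B by [].
by apply/eqP; rewrite finset.eqEsubset AB AC.
Qed.

Lemma nc_le_anti N : antisymmetric (@nc_le N).
Proof.
move=> p q /andP[pq qp]; apply/val_inj/eqP.
by rewrite finset.eqEsubset !nc_le_sub.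
Qed.

Fact nc_display : Order.disp_t. Proof. exact. Qed.

HB.instance Definition _ N := Order.Le_isPOrder.Build nc_display (NC N)
  (@nc_le_refl N) (@nc_le_anti N) (@nc_le_trans N).

Lemma polygon_vertex_inj N : injective (@polygon_vertex N).
Proof.
suff lt_neq (i j : 'I_N) : (i < j)%N -> polygon_vertex i <> polygon_vertex j.
  move=> i j ij; apply/val_inj; case: (ltngtP i j) => // [/lt_neq|/lt_neq] //.
  by move/(_ (esym ij)).
move=> ij /rowP e; have := e 0; have := e 1; rewrite !mxE/= => /oppr_inj es ec.
set a := 2 * pi * i%:R / N%:R in es ec; set b := 2 * pi * j%:R / N%:R in es ec.
have N0 : 0 < N%:R :> R by rewrite ltr0n (leq_ltn_trans (leq0n i) (ltn_ord i)).
have spos : 0 < sin ((b - a) / 2).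
  have -> : (b - a) / 2 = pi * ((j - i)%:R / N%:R).
    by rewrite /a /b natrB 1?ltnW//; field; rewrite gt_eqF.
  apply: sin_gt0_pi; rewrite mulr_gt0 ?pi_gt0 ?divr_gt0 ?N0 ?ltr0n ?subn_gt0//=.
  rewrite gtr_pMr ?pi_gt0// ltr_pdivrMr// mul1r ltr_nat.
  by rewrite (leq_ltn_trans (leq_subr _ _)).
have : cos (b - a) = 1 by rewrite cosB -ec -es -!expr2 cos2Dsin2.
rewrite [b - a]splitr -mulr2n cos_mulr2n => /eqP.
rewrite subr_eq -mulr2n eqrMn2r// cos2sin2 => /eqP h.
have /eqP : sin ((b - a) / 2) ^+ 2 = 0.
  by apply/eqP; rewrite -[_ == 0]oppr_eq0 -(inj_eq (addrI 1)) h addr0.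
by rewrite sqrf_eq0 => /eqP s0; rewrite s0 ltxx in spos.
Qed.

Lemma nc_bot_subproof N :
  finset.partition [set [set i] | i : 'I_N] [set: 'I_N] &&
  `[< noncrossing [set [set i] | i : 'I_N] >].
Proof.
apply/andP; split.
  apply/and3P; split.
  - apply/eqP/finset.setP => i; rewrite inE; apply/bigcupP.
    by exists [set i]; rewrite ?finset.set11// imset_f.
  - apply/finset.trivIsetP => _ _ /imsetP[i _ ->] /imsetP[j _ ->] ij.
    by rewrite disjoints1 inE; apply: contraNneq ij => ->.
  - by apply/negP => /imsetP[i _] /finset.setP/(_ i); rewrite !inE eqxx.
apply/asboolP => _ _ /imsetP[i _ ->] /imsetP[j _ ->] ij.
have hull1 k : (vertex_hull [set k] `<=` [set polygon_vertex k])%classic.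
  apply: smallest_sub; last by move=> _ [l /set1P -> <-].
  move=> x y l; rewrite !inE => -> ->.
  by rewrite convmm.
rewrite -subset0 => x [/hull1 /= -> /hull1 /= /polygon_vertex_inj e].
by rewrite e eqxx in ij.
Qed.

Definition nc_bot N : NC N := MkNC (nc_bot_subproof N).

Lemma nc_bot_le N (p : NC N) : (nc_bot N <= p)%O.
Proof.
apply/nc_leP => _ /imsetP[i _ ->].
have /and3P[/eqP cp _ _] := nc_partition p.
have : i \in finset.cover (nc_blocks p) by rewrite cp inE.
by case/bigcupP => B Bp iB; exists B; rewrite ?finset.sub1set.
Qed.

HB.instance Definition _ N :=
  Order.hasBottom.Build nc_display (NC N) (@nc_bot_le N).

Lemma nc_top_subproof n :
  finset.partition [set [set: 'I_n.+1]] [set: 'I_n.+1] &&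
  `[< noncrossing [set [set: 'I_n.+1]] >].
Proof.
apply/andP; split; last first.
  by apply/asboolP => A B /set1P -> /set1P ->; rewrite eqxx.
apply/and3P; split; first by rewrite /finset.cover big_set1.
- by apply/finset.trivIsetP => A B /set1P -> /set1P ->; rewrite eqxx.
- by apply/negP => /set1P /finset.setP/(_ ord0); rewrite !inE.
Qed.

Definition nc_top n : NC n.+1 := MkNC (nc_top_subproof n).

Lemma nc_le_top n (p : NC n.+1) : (p <= nc_top n)%O.
Proof. by apply/nc_leP => A _; exists finset.setT; rewrite ?finset.set11 ?finset.subsetT. Qed.

HB.instance Definition _ n :=
  Order.hasTop.Build nc_display (NC n.+1) (@nc_le_top n).

Definition nc_rank N (p : NC N) : nat := N - #|nc_blocks p|.

End NoncrossingPartitions.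

Section ParkingFunctions.
Context (n : nat).
Implicit Type rho : {ffun 'I_n -> 'I_n}.

(* Positions and values are shifted from {1, ..., n} to {0, ..., n - 1}: the
   preimage of {1, ..., k} becomes the set of i with rho i < k. *)
Definition parking rho : bool :=
  [forall k : 'I_n.+1, (k <= #|[set i | (rho i < k)%N]|)%N].

Definition des rho : nat :=
  #|[set ij : 'I_n * 'I_n |
      (ij.2 == ij.1.+1 :> nat) && (rho ij.2 < rho ij.1)%N]|.

Definition tieless rho : bool :=
  [forall i : 'I_n, forall j : 'I_n, (j == i.+1 :> nat) ==> (rho i != rho j)].

Definition tieless_parking : {set {ffun 'I_n -> 'I_n}} :=
  [set rho | parking rho && tieless rho].

End ParkingFunctions.

(* Main.v *)
Require Import Defs.
From mathcomp Require Import boolp classical_sets.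
From mathcomp Require Import reals interval_inference convex trigo.
From mathcomp Require Import all_boot all_order all_algebra.
From mathcomp Require Import ring zify lra.

(** Both sides are compared through counts with independent weights.  Write
    N = n + 1.

    Chains.  A multichain 0 <= p_1 <= ... <= p_m <= p_(m+1) = 1 of noncrossing
    partitions of N points is the same thing as an ultrametric d on the points,
    where d x y is the least j such that x and y lie in one block of p_j; that
    the p_j are noncrossing becomes the four point condition
    d a b <= max (d a c) (d b e) for a < b < c < e.  The rank of p_j is the
    number of points that are not the last of their block, so the rank jump
    from p_(j-1) to p_j is the number of points x with exit level j, where the
    exit level is the minimum of d x y over y > x.  Let G be the generating
    function, by number of points, of the ultrametrics weighted by the product
    of the y_(exit level of x), the last point counting for 1.  Cutting an
    ultrametric after the last point at distance < k from the first one
    ([cut_sum]) gives G_k = G_(k-1) (1 + y_k G), where G_k collects those in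
    which the first and last points are at distance at most k.  Hence
    G = z prod_k (1 + y_k G).

    Parking functions.  Reading off the coefficients of the powers of G, the
    sum over ultrametrics is the sum over the Lukasiewicz words of sets of
    colours, that is, over the tuples (S_1, ..., S_(m+1)) of subsets of the
    alphabet whose concatenation is a parking function, with weight the product
    of the y_i ^ |S_i| ([ultrametric_count]).  The factor w s = x [s - 1]_x of
    the Chow polynomial satisfies (1 - x) w s = x 1^s - x^s + (1 - x) 0^s, so
    that equality for all y in {0, 1, x} gives the equality with the y_i ^ s_i
    replaced by the w s_i ([polarization]).

    Tieless words.  It remains to see that a sum over tieless words weighted by
    x ^ des is a sum over sequences of sets of letters, all but the last one
    weighted by w ([smirnov_sum_blocks]).  This holds for every functional of
    words invariant under permutation of the letters, and comes from the
    identity H E(x) = E(1) (1 - x + x H), where H is the generating function of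
    tieless words and E(x) that of sets of letters weighted by x ^ size.  The
    identity is obtained by letting a threshold run through the alphabet
    ([mixed_sumS]). *)

Set Implicit Arguments.
Unset Strict Implicit.
Unset Printing Implicit Defensive.

Import Order.TTheory GRing.Theory Num.Theory.
Local Open Scope ring_scope.

(** * Sums over tieless words *)

Section Smirnov.
Context (A : comNzRingType) (x : A) (N : nat).
Implicit Types (w v : seq 'I_N) (f g : seq 'I_N -> A) (a b : 'I_N) (B : {set 'I_N}).

(** The sum of F over the words of length n in the alphabet 'I_N. *)
Fixpoint word_sum (n : nat) (F : seq 'I_N -> A) : A :=
  if n is n'.+1 then \sum_b word_sum n' (fun v => F (b :: v)) else F [::].

(** x ^ des w if no two consecutive letters of w are equal, and 0 otherwise. *)
Fixpoint smirnov_weight w : A :=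
  if w is b :: v then
    (if v is c :: _ then (if b == c then 0 else if (c < b)%N then x else 1)
     else 1) * smirnov_weight v
  else 1.

(** The part of degree n of the generating function H of tieless words, seen
    through the functional f. *)
Definition smirnov_sum n f := word_sum n (fun w => smirnov_weight w * f w).

Definition head_weight (a : nat) w : A :=
  if w is b :: _ then (if (b < a)%N then x else 1) else 1.

(** With a threshold a, words starting with a letter below a get an extra
    factor x: this interpolates between H (a = 0) and 1 + x (H - 1) (a = N). *)
Definition threshold_sum (a n : nat) f :=
  word_sum n (fun w => head_weight a w * smirnov_weight w * f w).

(** The word w starts with the letter a. *)
Definition heads a w := if w is b :: _ then b == a else false.

Definition head_sum a n f :=
  word_sum n (fun w => (heads a w)%:R * smirnov_weight w * f w).

Lemma eq_word_sum n F G : F =1 G -> word_sum n F = word_sum n G.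
Proof.
elim: n F G => [|n IH] F G FG //=; apply: eq_bigr => b _.
by apply: IH => v; apply: FG.
Qed.

Lemma word_sumD n F G :
  word_sum n (fun w => F w + G w) = word_sum n F + word_sum n G.
Proof.
elim: n F G => [|n IH] F G //=; rewrite -big_split /=; apply: eq_bigr => b _.
exact: IH.
Qed.

Lemma word_sumZ n c F : word_sum n (fun w => c * F w) = c * word_sum n F.
Proof.
elim: n F => [|n IH] F //=; rewrite big_distrr /=; apply: eq_bigr => b _.
exact: IH.
Qed.

Lemma word_sum0 n F : (forall w, size w = n -> F w = 0) -> word_sum n F = 0.
Proof.
elim: n F => [|n IH] F F0 /=; first exact: F0.
by apply: big1 => b _; apply: IH => w sw; apply: F0; rewrite /= sw.
Qed.

Lemma threshold_sumS a n f :
  threshold_sum a n f = threshold_sum a.+1 n f + (1 - x) * head_sum a n f.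
Proof.
rewrite -word_sumZ -word_sumD; apply: eq_word_sum => -[|b v] /=.
  by rewrite mul0r mul0r mulr0 addr0.
rewrite ltnS; case: (ltngtP b a) => [ba|ab|/val_inj->]; last by rewrite eqxx mulr1n; ring.
  rewrite -val_eqE /= (ltn_eqF ba) mulr0n; ring.
by rewrite -val_eqE /= (gtn_eqF ab) mulr0n; ring.
Qed.

(** Removing the first letter a of a word costs a factor x if the next letter
    is below a, 1 if it is above, and 0 if it is a again. *)
Lemma head_sum_rec a n f :
  head_sum a n.+1 f = threshold_sum a n (fun v => f (a :: v))
                      - head_sum a n (fun v => f (a :: v)).
Proof.
rewrite /head_sum /= (bigD1 a) //= [X in _ + X]big1 ?addr0; last first.
  move=> b /negPf ba; apply: word_sum0 => w _.
  by rewrite ba !mul0r.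
rewrite -mulN1r -word_sumZ -word_sumD; apply: eq_word_sum => -[|b v] /=.
  by rewrite eqxx mulr1n; ring.
rewrite eqxx [a == b]eq_sym; case: eqVneq => [->|_]; last by rewrite mulr1n mulr0n; ring.
by rewrite ltnn !mulr1n; ring.
Qed.

(** In generating functions, Q_(a+1) (1 + z_a) = Q_a (1 + x z_a), where Q_a is
    the generating function of [threshold_sum] and z_a stands for the letter a. *)
Lemma threshold_exchange a n f (fa := fun v => f (a :: v)) :
  threshold_sum a.+1 n.+1 f + threshold_sum a.+1 n fa =
  threshold_sum a n.+1 f + x * threshold_sum a n fa.
Proof.
rewrite (threshold_sumS a n.+1) head_sum_rec -/fa (threshold_sumS a n).
by ring.
Qed.

Definition perm_invariant f := forall v w, perm_eq v w -> f v = f w.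

(** Words with threshold a together with a set of letters, where the letters
    of the set that are at least a count with a factor x. *)
Definition mixed_sum (a n : nat) f :=
  \sum_(B : {set 'I_N} | (#|B| <= n)%N) x ^+ #|[set b in B | (a <= b)%N]| *
     threshold_sum a (n - #|B|) (fun v => f (enum B ++ v)).

Lemma big_set_split (a : 'I_N) (F : {set 'I_N} -> A) :
  \sum_B F B = \sum_(B : {set 'I_N} | a \notin B) (F B + F (a |: B)).
Proof.
rewrite big_split /= (bigID (fun B : {set _} => a \notin B)) /=; congr (_ + _).
rewrite (reindex_onto (fun B : {set 'I_N} => a |: B) (fun B : {set _} => B :\ a)) /=; last first.
  by move=> B; rewrite negbK => /setD1K.
apply: eq_bigl => B; rewrite negbK setU11 /=.
by apply/eqP/idP => [<-|/setU1K //]; rewrite setD11.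
Qed.

Lemma enum_setU1 a B : a \notin B -> perm_eq (enum (a |: B)) (a :: enum B).
Proof.
move=> aB; apply: uniq_perm; rewrite /= ?enum_uniq ?mem_enum ?aB //.
by move=> b; rewrite in_cons !mem_enum !inE.
Qed.

(** The mixed sum does not depend on the threshold: decide whether a belongs to
    the set B, and exchange the letter a between the set and the word by
    [threshold_exchange]. *)
Lemma mixed_sumS a n f : perm_invariant f -> mixed_sum a.+1 n f = mixed_sum a n f.
Proof.
move=> pf; rewrite /mixed_sum big_mkcond [RHS]big_mkcond /=.
rewrite (big_set_split a) [RHS](big_set_split a).
apply: eq_bigr => B aB; rewrite cardsU1 aB add1n.
have -> : [set b in B | (a < b)%N] = [set b in B | (a <= b)%N].
  apply/setP => b; rewrite !inE; case: (boolP (b \in B)) => //= bB.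
  rewrite ltn_neqAle; case: eqP => //= /val_inj ab.
  by rewrite ab bB in aB.
have -> : [set b in a |: B | (a < b)%N] = [set b in B | (a <= b)%N].
  apply/setP => b; rewrite !inE; case: (eqVneq b a) => [->|ba] /=.
    by rewrite ltnn (negPf aB).
  by rewrite ltn_neqAle eq_sym -val_eqE in ba *; rewrite ba.
have -> : [set b in a |: B | (a <= b)%N] = a |: [set b in B | (a <= b)%N].
  by apply/setP => b; rewrite !inE; case: (eqVneq b a) => [->|ba] //=; rewrite leqnn.
rewrite cardsU1 !inE (negPf aB) /= add1n exprS.
set k := #|[set b in B | (a <= b)%N]|.
have sub c m : threshold_sum c m (fun v => f (enum (a |: B) ++ v)) =
    threshold_sum c m (fun v => f (enum B ++ a :: v)).
  apply: eq_word_sum => v; congr (_ * _); apply: pf.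
  apply: perm_trans (_ : perm_eq _ ((a :: enum B) ++ v)) _.
    by rewrite perm_cat2r enum_setU1.
  by rewrite perm_sym -cat1s perm_catCA.
rewrite !sub; case: (ltngtP #|B| n) => [Bn|//|Bn]; rewrite ?addr0.
- have -> : (n - #|B| = (n - #|B|.+1).+1)%N by rewrite subnS prednK // subn_gt0.
  rewrite -mulrDr threshold_exchange; ring.
- by rewrite Bn subnn.
Qed.

(** The identity H E(x) = E(1) (1 - x + x H), in degree n, obtained by comparing
    the thresholds 0 and N. *)
Lemma smirnov_sum_exchange n f : perm_invariant f ->
  \sum_(B : {set 'I_N} | (#|B| <= n)%N)
     x ^+ #|B| * smirnov_sum (n - #|B|) (fun v => f (enum B ++ v)) =
  (1 - x) * (\sum_(B : {set 'I_N} | (#|B| == n)%N) f (enum B)) +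
  x * \sum_(B : {set 'I_N} | (#|B| <= n)%N) smirnov_sum (n - #|B|) (fun v => f (enum B ++ v)).
Proof.
move=> pf; have E0 : mixed_sum 0 n f = mixed_sum N n f.
  have: forall k : nat, (k <= N)%N -> mixed_sum 0 n f = mixed_sum k n f.
    elim=> [|k IH] kN; first by [].
    by rewrite (IH (ltnW kN)) -(mixed_sumS (Ordinal kN)).
  exact: (fun h => h N (leqnn N)).
transitivity (mixed_sum 0 n f).
  apply: eq_bigr => B _; congr (x ^+ _ * _).
    by apply: eq_card => b; rewrite !inE andbT.
  by apply: eq_word_sum => -[|b v] /=; rewrite ?ltn0 !mul1r.
rewrite E0 /mixed_sum !big_distrr /=.
have -> : \sum_(B : {set 'I_N} | #|B| == n) (1 - x) * f (enum B) =
    \sum_(B : {set 'I_N} | (#|B| <= n)%N)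
      if #|B| == n then (1 - x) * f (enum B) else 0.
  rewrite -big_mkcondr; apply: eq_bigl => B.
  by case: eqP => [->|]; rewrite ?leqnn ?andbF.
rewrite -big_split /=; apply: eq_bigr => B Bn.
have -> : [set b in B | (N <= b)%N] = set0.
  by apply/setP => b; rewrite !inE leqNgt ltn_ord andbF.
rewrite cards0 expr0 mul1r.
have [->|Bn'] := eqVneq #|B| n.
  by rewrite subnn /threshold_sum /smirnov_sum /= cats0; ring.
have : (0 < n - #|B|)%N by rewrite subn_gt0 ltn_neqAle Bn'.
case: (n - #|B|)%N => // m _; rewrite add0r /smirnov_sum -word_sumZ.
rewrite /threshold_sum /=; apply: eq_bigr => b _; apply: eq_word_sum => v /=.
by rewrite ltn_ord !mulrA.
Qed.

End Smirnov.

Lemma big_tuple_cons (A : nmodType) (T : finType) n (F : n.+1.-tuple T -> A) :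
  \sum_(t : n.+1.-tuple T) F t =
  \sum_(b : T) \sum_(t : n.-tuple T) F [tuple of b :: t].
Proof.
rewrite pair_big /=.
rewrite (reindex (fun p : T * n.-tuple T => [tuple of p.1 :: p.2])) //=.
exists (fun t => (thead t, [tuple of behead t])) => [[b t] _|t _] /=.
  by rewrite theadE; congr pair; apply: val_inj.
by rewrite -tuple_eta.
Qed.

Lemma word_sum_tuple (A : comNzRingType) N n (F : seq 'I_N -> A) :
  word_sum n F = \sum_(t : n.-tuple 'I_N) F t.
Proof.
elim: n F => [|n IH] F /=.
  by rewrite (big_pred1 [tuple]) // => t; apply/esym/eqP/tuple0.
by rewrite big_tuple_cons; apply: eq_bigr => b _; rewrite IH.
Qed.

Section Blocks.
Context (A : comNzRingType) (N : nat).
Implicit Types (f : seq 'I_N -> A) (B : {set 'I_N}) (ws : seq (nat -> A)).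

(** The sum over tuples of sets of letters (S_1, ..., S_k), with the factor
    w_i |S_i| for the i-th set, of the value of f on the concatenation of the
    S_i, each listed as a word. *)
Fixpoint block_sum ws f : A :=
  if ws is w :: ws' then
    \sum_(B : {set 'I_N}) w #|B| * block_sum ws' (fun v => f (enum B ++ v))
  else f [::].

Lemma block_sum_tuple ws f K (E : size ws = K) :
  block_sum ws f = \sum_(S : K.-tuple {set 'I_N})
    (\prod_(i < K) nth (fun=> 0) ws i #|tnth S i|)
    * f (flatten [seq enum (B : {set 'I_N}) | B : {set 'I_N} <- S]).
Proof.
subst K; elim: ws f => [|w ws IH] f /=.
  rewrite (big_pred1 [tuple]) ?big_ord0 ?mul1r // => t.
  exact/esym/eqP/tuple0.
rewrite big_tuple_cons; apply: eq_bigr => B _.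
rewrite IH big_distrr; apply: eq_bigr => S _ /=.
rewrite big_ord_recl /= mulrA; congr (_ * _ * _).
by apply: eq_bigr => i _; rewrite tnthS.
Qed.

Lemma block_sum0 ws f : f =1 (fun=> 0) -> block_sum ws f = 0.
Proof.
elim: ws f => [|w ws IH] f f0 /=; first exact: f0.
by apply: big1 => B _; rewrite IH ?mulr0 // => v; apply: f0.
Qed.

End Blocks.

Section SmirnovBlocks.
Context (A : idomainType) (x : A) (w : nat -> A) (N : nat).
Context (x1 : 1 - x != 0).
Context (w0 : w 0 = 0).
Context (wS : forall k, (1 - x) * w k.+1 = x - x ^+ k.+1).
Implicit Types (f : seq 'I_N -> A) (B : {set 'I_N}).

Lemma smirnov_sum_rec n f : perm_invariant f ->
  smirnov_sum x n f = \sum_(B : {set 'I_N} | #|B| == n) f (enum B) +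
    \sum_(B : {set 'I_N} | (#|B| <= n)%N)
      w #|B| * smirnov_sum x (n - #|B|) (fun v => f (enum B ++ v)).
Proof.
move=> pf; apply: (mulfI x1); rewrite mulrDr.
set T := fun B : {set 'I_N} => smirnov_sum x (n - #|B|) (fun v => f (enum B ++ v)).
have E : \sum_(B : {set 'I_N} | (#|B| <= n)%N) x ^+ #|B| * T B =
    (1 - x) * (\sum_(B : {set 'I_N} | #|B| == n) f (enum B)) +
    x * \sum_(B : {set 'I_N} | (#|B| <= n)%N) T B.
  exact: smirnov_sum_exchange.
suff -> : (1 - x) * smirnov_sum x n f =
    (1 - x) * (\sum_(B : {set 'I_N} | (#|B| <= n)%N) w #|B| * T B)
    + (\sum_(B : {set 'I_N} | (#|B| <= n)%N) x ^+ #|B| * T B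
       - x * \sum_(B : {set 'I_N} | (#|B| <= n)%N) T B).
  by rewrite E addrK addrC.
rewrite !big_distrr -sumrB -big_split /= (bigD1 set0) ?cards0 //= big1 => [|B /andP[_ B0]].
  rewrite w0 expr0 addr0 mul0r mulr0 add0r -mulrBl.
  congr (_ * _); rewrite /T cards0 subn0; apply: eq_word_sum => v.
  by rewrite enum_set0.
move: B0; rewrite -card_gt0; case: #|B| => // k _.
by rewrite mulrA wS; ring.
Qed.

(** f vanishes on the words of length different from n. *)
Definition supported n f := forall v, size v != n -> f v = 0.

(** A sum over tieless words expands over sequences of sets of letters; all sets
    but the last one are weighted by w, which vanishes at 0, so that only sequences of length at most
    n + 1 contribute. *)
Lemma smirnov_sum_blocks n f M : perm_invariant f -> supported n f -> (n < M)%N ->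
  smirnov_sum x n f = \sum_(m < M) block_sum (nseq m w ++ [:: fun=> 1]) f.
Proof.
elim: M n f => // M IH n f pf sf; rewrite ltnS => nM.
rewrite smirnov_sum_rec // big_ord_recl /=; congr (_ + _).
  rewrite big_mkcond; apply: eq_bigr => B _; rewrite mul1r cats0.
  by case: ifP => // /negbT Bn; rewrite sf // -cardE.
rewrite exchange_big /= big_mkcond; apply: eq_bigr => B _.
rewrite -big_distrr /=; case: (posnP #|B|) => [->|B0].
  by rewrite w0 !mul0r.
case: ifP => Bn.
  congr (_ * _); apply: IH; last first.
  - by apply: leq_trans nM; rewrite ltn_subrL B0 (leq_trans B0 Bn).
  - move=> v sv; apply: sf; rewrite size_cat -cardE.
    by apply: contra sv => /eqP <-; rewrite addKn.
  - by move=> u v uv; apply: pf; rewrite perm_cat2l.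
rewrite big1 ?mulr0 // => m _; apply: block_sum0 => v; apply: sf.
rewrite size_cat -cardE; apply: contraFN Bn => /eqP <-.
exact: leq_addr.
Qed.

End SmirnovBlocks.

(** * Noncrossing ultrametrics and their decomposition *)

Section Ultrametric.
Context (K : nat).

(** Noncrossing ultrametrics on N points on a circle: the balls of any given
    radius form a noncrossing partition. *)
Record nc_ultrametric N (d : 'I_N -> 'I_N -> nat) : Prop := NCUltrametric {
  dist_eq0 : forall x y, (d x y == 0)%N = (x == y);
  dist_sym : forall x y, d x y = d y x;
  dist_max : forall x y z, (d x z <= maxn (d x y) (d y z))%N;
  dist_cross : forall a b c e : 'I_N, (a < b)%N -> (b < c)%N -> (c < e)%N ->
    (d a b <= maxn (d a c) (d b e))%N }.

(** Candidate ultrametrics with values in {0, ..., K}; K is the number of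
    colours, the distance 0 being no colour. *)
Definition dist_matrix N := {ffun 'I_N * 'I_N -> 'I_K.+1}.
Implicit Types N : nat.

Definition dist N (d : dist_matrix N) (x y : 'I_N) : nat := d (x, y).

Definition nc_ultrametricb N (d : dist_matrix N) : bool :=
  [&& [forall x, forall y, (dist d x y == 0)%N == (x == y)],
      [forall x, forall y, dist d x y == dist d y x],
      [forall x, forall y, forall z, dist d x z <= maxn (dist d x y) (dist d y z)]%N
    & [forall a : 'I_N, forall b : 'I_N, forall c : 'I_N, forall e : 'I_N,
        [&& a < b, b < c & c < e] ==> (dist d a b <= maxn (dist d a c) (dist d b e))]%N].

Lemma nc_ultrametricP N (d : dist_matrix N) : reflect (nc_ultrametric (dist d)) (nc_ultrametricb d).
Proof.
apply: (iffP and4P) => [[h0 hC hT hX]|[h0 hC hT hX]]; split.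
- by move=> x y; have /forallP/(_ x)/forallP/(_ y)/eqP := h0.
- by move=> x y; have /forallP/(_ x)/forallP/(_ y)/eqP := hC.
- by move=> x y z; have /forallP/(_ x)/forallP/(_ y)/forallP/(_ z) := hT.
- move=> a b c e ab bc ce.
  have /forallP/(_ a)/forallP/(_ b)/forallP/(_ c)/forallP/(_ e)/implyP := hX.
  by apply; rewrite ab bc ce.
- by apply/forallP => x; apply/forallP => y; rewrite h0.
- by apply/forallP => x; apply/forallP => y; rewrite hC.
- by apply/forallP => x; apply/forallP => y; apply/forallP => z.
- apply/forallP => a; apply/forallP => b; apply/forallP => c; apply/forallP => e.
  by apply/implyP => /and3P[ab bc ce]; apply: hX.
Qed.

(** The least distance from x to a later point, and K + 1 if x is the last point:
    x is the last point of its ball of radius j exactly for j < exit_level d x. *)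
Definition exit_level N (d : dist_matrix N) (x : 'I_N) : nat :=
  foldr minn K.+1 [seq dist d x y | y : 'I_N <- enum 'I_N & (x < y)%N].

Lemma exit_level_le N (d : dist_matrix N) x j :
  (exit_level d x <= j)%N = (K < j)%N || [exists y : 'I_N, (x < y)%N && (dist d x y <= j)%N].
Proof.
have fm s : (foldr minn K.+1 s <= j)%N = (K < j)%N || has (leq^~ j) s.
  by elim: s => [|a s IH] /=; rewrite ?orbF // geq_min IH orbCA.
rewrite /exit_level fm has_map has_filter -filter_predI -has_filter; congr (_ || _).
apply/hasP/existsP => [[y _ /andP[/= h1 h2]]|[y /andP[h1 h2]]]; exists y.
- by rewrite h1 h2.
- by rewrite mem_enum.
- by rewrite /= h1 h2.
Qed.

Lemma eq_exit_level N N' (d : dist_matrix N) (d' : dist_matrix N') (x : 'I_N) (x' : 'I_N') :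
  (forall j, (j <= K)%N ->
    [exists y : 'I_N, (x < y)%N && (dist d x y <= j)%N] =
    [exists y : 'I_N', (x' < y)%N && (dist d' x' y <= j)%N]) ->
  exit_level d x = exit_level d' x'.
Proof.
move=> h; have H j : (exit_level d x <= j)%N = (exit_level d' x' <= j)%N.
  by rewrite !exit_level_le; case: ltnP => //= /h.
by apply/eqP; rewrite eqn_leq -H leqnn H leqnn.
Qed.

Section Glue.
Context (a b k : nat) (kK : (k <= K)%N).
Local Notation mL := (dist_matrix a.+1).
Local Notation mR := (dist_matrix b.+1).
Local Notation m := (dist_matrix (a.+1 + b.+1)).

(** Distance between a point x of the left part and a point y of the right part
    when the first point of the left part is put at distance k from the last
    point of the right part. *)
Definition across (dL : mL) (dR : mR) x y : nat :=
  maxn k (maxn (dist dL x ord0) (dist dR y ord_max)).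

(** The ultrametric on a concatenation of two intervals of points with given
    restrictions and joined at level k through the first and the last points. *)
Definition glue (dL : mL) (dR : mR) : m :=
  [ffun p => match split p.1, split p.2 with
    | inl x, inl y => dL (x, y)
    | inr x, inr y => dR (x, y)
    | inl x, inr y => inord (across dL dR x y)
    | inr y, inl x => inord (across dL dR x y)
    end].

Definition restrL (d : m) : mL := [ffun p => d (lshift _ p.1, lshift _ p.2)].
Definition restrR (d : m) : mR := [ffun p => d (rshift _ p.1, rshift _ p.2)].

Lemma dist_restrL d x y : dist (restrL d) x y = dist d (lshift _ x) (lshift _ y).
Proof. by rewrite /dist ffunE. Qed.

Lemma dist_restrR d x y : dist (restrR d) x y = dist d (rshift _ x) (rshift _ y).
Proof. by rewrite /dist ffunE. Qed.

Lemma splitl x : split (lshift b.+1 x : 'I_(a.+1 + b.+1)) = inl x.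
Proof. exact: (unsplitK (inl x)). Qed.

Lemma splitr x : split (rshift a.+1 x : 'I_(a.+1 + b.+1)) = inr x.
Proof. exact: (unsplitK (inr x)). Qed.

Lemma across_lt dL dR x y : (across dL dR x y < K.+1)%N.
Proof. by rewrite ltnS !geq_max kK -ltnS ltn_ord -ltnS ltn_ord. Qed.

Lemma glueLL dL dR x y : dist (glue dL dR) (lshift _ x) (lshift _ y) = dist dL x y.
Proof. by rewrite /dist ffunE /= !splitl. Qed.
Lemma glueRR dL dR x y : dist (glue dL dR) (rshift _ x) (rshift _ y) = dist dR x y.
Proof. by rewrite /dist ffunE /= !splitr. Qed.
Lemma glueLR dL dR x y :
  dist (glue dL dR) (lshift _ x) (rshift _ y) = across dL dR x y.
Proof. by rewrite /dist ffunE /= splitl splitr inordK // across_lt. Qed.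
Lemma glueRL dL dR x y :
  dist (glue dL dR) (rshift _ y) (lshift _ x) = across dL dR x y.
Proof. by rewrite /dist ffunE /= splitl splitr inordK // across_lt. Qed.
Definition glueE := (glueLL, glueRR, glueLR, glueRL).

Lemma restrL_glue dL dR : restrL (glue dL dR) = dL.
Proof. by apply/ffunP => -[x y]; rewrite [LHS]ffunE; apply/val_inj; apply: glueLL. Qed.
Lemma restrR_glue dL dR : restrR (glue dL dR) = dR.
Proof. by apply/ffunP => -[x y]; rewrite [LHS]ffunE; apply/val_inj; apply: glueRR. Qed.

Lemma restrL_ultrametric d : nc_ultrametric (dist d) -> nc_ultrametric (dist (restrL d)).
Proof.
case=> h0 hC hT hX; split=> *; rewrite !dist_restrL.
- by rewrite h0 (inj_eq (@lshift_inj _ _)).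
- exact: hC.
- exact: hT.
- exact: hX.
Qed.

Lemma restrR_ultrametric d : nc_ultrametric (dist d) -> nc_ultrametric (dist (restrR d)).
Proof.
case=> h0 hC hT hX; split=> *; rewrite !dist_restrR.
- by rewrite h0 (inj_eq (@rshift_inj _ _)).
- exact: hC.
- exact: hT.
- by apply: hX; rewrite /= ltn_add2l.
Qed.

Lemma glue_ultrametric dL dR : (0 < k)%N ->
  nc_ultrametric (dist dL) -> nc_ultrametric (dist dR) -> (dist dL ord0 ord_max < k)%N ->
  nc_ultrametric (dist (glue dL dR)).
Proof.
move=> k0 [L0 LC LT LX] [R0 RC RT RX] Lk; split.
- move=> x y; case: (split_ordP x) => x' ->; case: (split_ordP y) => y' ->;
    rewrite glueE ?eq_lshift ?eq_rshift ?eq_lrshift ?eq_rlshift ?L0 ?R0 //;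
    by rewrite /across -leqn0 !geq_max leqn0 (gtn_eqF k0).
- move=> x y; case: (split_ordP x) => x' ->; case: (split_ordP y) => y' ->;
    by rewrite !glueE.
- move=> x y z; case: (split_ordP x) => x' ->; case: (split_ordP y) => y' ->;
    case: (split_ordP z) => z' ->; rewrite !glueE ?LT ?RT // /across.
  + by have := LT x' y' ord0; lia.
  + by have := LT x' ord0 z'; rewrite (LC ord0); lia.
  + by have := RT z' y' ord_max; rewrite (RC z' y'); lia.
  + by have := LT z' y' ord0; rewrite (LC z' y'); lia.
  + by have := RT x' ord_max z'; rewrite (RC ord_max); lia.
  + by have := RT x' y' ord_max; lia.
- move=> x y z t; case: (split_ordP x) => x' ->; case: (split_ordP y) => y' ->;
    case: (split_ordP z) => z' ->; case: (split_ordP t) => t' ->; rewrite !glueE /=;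
    move=> xy yz zt; try by [have := ltn_ord x'; have := ltn_ord y';
      have := ltn_ord z'; have := ltn_ord t'; lia].
  + exact: LX.
  + rewrite /across; have h1 := LT y' ord0 ord_max.
    have := ltn_ord z'; rewrite ltnS leq_eqVlt => /orP[/eqP za|za].
      have -> : z' = ord_max by apply: val_inj.
      have := LT x' ord_max y'; rewrite (LC ord_max y'); lia.
    by have := LX x' y' z' ord_max xy yz za; lia.
  + by rewrite /across; have := LT x' ord0 y'; rewrite (LC ord0); lia.
  + rewrite /across; have := ltn_ord t'; rewrite ltnS leq_eqVlt => /orP[/eqP ta|ta].
      have -> : t' = ord_max by apply: val_inj.
      lia.
    have {}yz : (y' < z')%N by lia.
    have {}zt : (z' < t')%N by lia.
    have := RX y' z' t' ord_max yz zt ta; have := RT y' z' ord_max; lia.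
  + by apply: RX; lia.
Qed.

(** The left part ends at the last point at distance less than k from the
    first point. *)
Definition cut_at (d : m) : bool :=
  (dist d (lshift _ ord0) (lshift _ ord_max) < k)%N &&
  [forall y : 'I_b.+1, k <= dist d (lshift _ ord0) (rshift _ y)]%N.

(** Conversely, the distance across the cut is forced: below level k the left
    part is enclosed by the ball of the first point, which ends at the cut, and
    the points x and y on either side can only be joined through the first and
    the last points. *)
Lemma glue_restr d : nc_ultrametric (dist d) ->
  dist d (lshift _ ord0) (rshift _ ord_max) = k -> cut_at d ->
  glue (restrL d) (restrR d) = d.
Proof.
case=> h0 hC hT hX dk /andP[d0 /forallP d1].
have LR x y : across (restrL d) (restrR d) x y = dist d (lshift _ x) (rshift _ y).
  rewrite /across dist_restrL dist_restrR.
  have d1y := d1 y.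
  set X := lshift _ x; set Y := rshift _ y in d1y *.
  set O := lshift _ ord0 in d0 dk d1y *; set Z := rshift _ ord_max in dk *.
  set M := lshift _ ord_max in d0.
  have kXY : (k <= dist d X Y)%N.
    have [x0|x0] := posnP x.
      by have -> : X = O; [apply: val_inj|].
    have [xa|xa] := eqVneq (val x) a.
      have -> : X = M by apply: val_inj.
      by have := hT O M Y; lia.
    have := hX O X M Y x0; rewrite /= => h.
    have := hT O X Y; have := ltn_ord x; move: xa h => /= xa h xa'.
    by have := h ltac:(lia) ltac:(lia); lia.
  have h1 : (dist d X Y <= maxn (dist d X O) (maxn k (dist d Y Z)))%N.
    have := hT X O Y; have := hT O Z Y; rewrite dk (hC Z Y); lia.
  have h2 : (dist d X O <= dist d X Y)%N.
    have [x0|x0] := posnP x.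
      have -> : X = O by apply: val_inj.
      by have /eqP-> : (dist d O O == 0)%N by rewrite h0.
    have [xa|xa] := eqVneq (val x) a.
      have EX : X = M by apply: val_inj.
      by move: kXY; rewrite EX (hC M O); lia.
    have := hX O X M Y x0; rewrite /= => h.
    have xa' := ltn_ord x; have {}xa : (x != a :> nat)%N by [].
    have := h ltac:(lia) ltac:(lia); rewrite (hC X O); lia.
  have h3 : (dist d Y Z <= dist d X Y)%N.
    have := hT Y X Z; have := hT X O Z; rewrite dk (hC Y X); lia.
  lia.
suff H x y : dist (glue (restrL d) (restrR d)) x y = dist d x y.
  by apply/ffunP => -[x y]; apply/val_inj/H.
case: (split_ordP x) => x' ->; case: (split_ordP y) => y' ->;
  by rewrite glueE ?dist_restrL ?dist_restrR // LR // hC.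
Qed.

Lemma exit_level_glueL dL dR (x : 'I_a.+1) : nc_ultrametric (dist dL) ->
  (dist dL ord0 ord_max < k)%N -> (x < a)%N ->
  exit_level (glue dL dR) (lshift _ x) = exit_level dL x.
Proof.
case=> h0 hC hT hX dk xa; apply: eq_exit_level => j _.
apply/existsP/existsP => [[y]|[y /andP[xy dj]]]; last first.
  by exists (lshift _ y); rewrite glueE xy.
case: (split_ordP y) => y' ->; rewrite glueE.
  by exists y'.
move=> /andP[_]; rewrite /across => h; exists ord_max; rewrite xa /=.
by have := hT x ord0 ord_max; lia.
Qed.

(** Gluing at level k turns the last point of the left part, which had no later
    point, into a point of exit level k; all other exit levels are unchanged. *)
Lemma exit_level_glueM dL dR : nc_ultrametric (dist dL) -> nc_ultrametric (dist dR) ->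
  (dist dL ord0 ord_max < k)%N ->
  exit_level (glue dL dR) (lshift _ ord_max) = k.
Proof.
move=> [L0 LC _ _] [R0 _ _ _] dk.
have R00 : dist dR ord_max ord_max = 0%N by apply/eqP; rewrite R0.
have H j : (exit_level (glue dL dR) (lshift _ ord_max) <= j)%N = (k <= j)%N.
  rewrite exit_level_le; case: (leqP k j) => [kj|jk].
    apply/orP; right; apply/existsP; exists (rshift _ ord_max).
    rewrite glueE /across R00 (LC ord_max) /=; apply/andP; split; lia.
  apply/negbTE; rewrite negb_or; apply/andP; split; first lia.
  apply/existsPn => y; case: (split_ordP y) => y' ->; rewrite glueE.
    by have := ltn_ord y'; rewrite /=; lia.
  by rewrite /across; lia.
by apply/eqP; rewrite eqn_leq H leqnn -H leqnn.
Qed.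

Lemma exit_level_glueR dL dR (x : 'I_b.+1) :
  exit_level (glue dL dR) (rshift _ x) = exit_level dR x.
Proof.
apply: eq_exit_level => j _.
apply/existsP/existsP => [[y]|[y /andP[xy dj]]]; last first.
  by exists (rshift _ y); rewrite glueE /= ltn_add2l xy.
case: (split_ordP y) => y' ->; rewrite glueE /=.
  by have := ltn_ord y'; lia.
by rewrite ltn_add2l => h; exists y'.
Qed.

End Glue.

Lemma exit_level_max n (d : dist_matrix n.+1) : exit_level d ord_max = K.+1.
Proof.
have H j : (exit_level d ord_max <= j)%N = (K < j)%N.
  rewrite exit_level_le; case: ltnP => //= _; apply/existsP => -[y /andP[]].
  by have := ltn_ord y; rewrite /=; lia.
by apply/eqP; rewrite eqn_leq H leqnn -H leqnn.
Qed.

End Ultrametric.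

Section WeightedCount.
Context (A : comNzRingType) (K : nat) (y : nat -> A).
Context (yK : y K.+1 = 1).

(** The generic weight: each point contributes y at its exit level. *)
Definition exit_weight N (d : dist_matrix K N) : A := \prod_x y (exit_level d x).

(** Weighted count of the noncrossing ultrametrics on n + 1 points whose first
    and last points are at distance at most k. *)
Definition ultrametric_sum (k n : nat) : A :=
  \sum_(d : dist_matrix K n.+1 | nc_ultrametricb d && (dist d ord0 ord_max <= k)%N) exit_weight d.

Lemma ultrametric_sum0 n : ultrametric_sum 0 n = (n == 0%N)%:R.
Proof.
rewrite /ultrametric_sum; case: n => [|n] /=.
  rewrite (big_pred1 [ffun=> ord0]) => [|d] /=.
    rewrite /exit_weight big_ord1 (_ : ord0 = ord_max :> 'I_1) ?exit_level_max //; exact: val_inj.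
  apply/andP/eqP => [[/nc_ultrametricP[h0 _ _ _] _]|->].
    apply/ffunP => -[i j]; rewrite ffunE; apply/val_inj/eqP => /=.
    by have -> := h0 i j; rewrite !ord1.
  split; last by rewrite /dist ffunE.
  by apply/nc_ultrametricP; split=> *; rewrite /dist !ffunE // !ord1 eqxx.
rewrite big1 // => d /andP[/nc_ultrametricP[h0 _ _ _]].
by rewrite leqn0 h0.
Qed.

Lemma exit_weight_glue a b k (dL : dist_matrix K a.+1) (dR : dist_matrix K b.+1) : (k <= K)%N ->
  nc_ultrametric (dist dL) -> nc_ultrametric (dist dR) -> (dist dL ord0 ord_max < k)%N ->
  exit_weight (glue k dL dR) = y k * (exit_weight dL * exit_weight dR).
Proof.
move=> kK nL nR dk; rewrite /exit_weight big_split_ord /= mulrA; congr (_ * _); last first.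
  by apply: eq_bigr => x _; rewrite exit_level_glueR.
rewrite !big_ord_recr /= exit_level_max yK mulr1 mulrC exit_level_glueM //; congr (_ * _).
by apply: eq_bigr => x _; rewrite exit_level_glueL /= ?ltn_ord.
Qed.

(** The ultrametrics whose first and last points are at distance k, with a given
    cut, are the pairs of an ultrametric on the left whose first and last points
    are at distance less than k and of an ultrametric on the right. *)
Lemma cut_sum a b k : (0 < k)%N -> (k <= K)%N ->
  \sum_(d : dist_matrix K (a.+1 + b.+1) |
      [&& nc_ultrametricb d, dist d (lshift _ ord0) (rshift _ ord_max) == k & cut_at k d])
     exit_weight d = y k * (ultrametric_sum k.-1 a * ultrametric_sum K b).
Proof.
move=> k0 kK.
rewrite (reindex_onto (fun p => glue k p.1 p.2)
   (fun d => (@restrL K a b d, @restrR K a b d))) /=; last first.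
  by move=> d /and3P[/nc_ultrametricP nd /eqP dk cd]; apply: glue_restr.
rewrite big_distrlr pair_big big_distrr /=; apply: eq_big => [[dL dR]|[dL dR]] /=.
  rewrite restrL_glue restrR_glue eqxx andbT -ltnS prednK //.
  have -> : (dist dR ord0 ord_max <= K)%N by rewrite -ltnS ltn_ord.
  rewrite andbT /cut_at !glueE //; apply/idP/idP.
    case/and3P => /nc_ultrametricP n _ /andP[-> _]; rewrite andbT.
    apply/andP; split; apply/nc_ultrametricP.
      by rewrite -(restrL_glue k dL dR); apply: restrL_ultrametric.
    by rewrite -(restrR_glue k dL dR); apply: restrR_ultrametric.
  case/andP => /andP[/nc_ultrametricP nL dk] /nc_ultrametricP nR; apply/and3P; split.
  - by apply/nc_ultrametricP; apply: glue_ultrametric.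
  - case: nL nR => L0 _ _ _ [R0 _ _ _]; rewrite /across.
    have /eqP -> : (dist dL ord0 ord0 == 0)%N by rewrite L0.
    have /eqP -> : (dist dR ord_max ord_max == 0)%N by rewrite R0.
    by rewrite !maxn0.
  - rewrite dk; apply/forallP => z; rewrite glueE // /across; lia.
case/andP => /and3P[/nc_ultrametricP n _ /andP[+ _]] _; rewrite glueE // => dk.
apply: exit_weight_glue => //.
  by rewrite -(restrL_glue k dL dR); apply: restrL_ultrametric.
by rewrite -(restrR_glue k dL dR); apply: restrR_ultrametric.
Qed.

(** The point of index a is the last one at distance less than k from the first
    point; this is [cut_at] with the position of the cut as a parameter. *)
Definition cut n k (d : dist_matrix K n.+1) (a : nat) :=
  (dist d ord0 (inord a) < k)%N &&
  [forall z : 'I_n.+1, (a < z)%N ==> (k <= dist d ord0 z)%N].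

(** The relation G_(k+1) = G_k (1 + y_(k+1) G_K) between generating functions by
    number of points, coefficient by coefficient. *)
Lemma ultrametric_sumS k n : (k < K)%N ->
  ultrametric_sum k.+1 n = ultrametric_sum k n
    + y k.+1 * \sum_(a < n) ultrametric_sum k a * ultrametric_sum K (n - a.+1).
Proof.
move=> kK; rewrite /ultrametric_sum.
rewrite (bigID (fun d : dist_matrix K n.+1 => (dist d ord0 ord_max <= k)%N)) /=.
congr (_ + _); first by apply: eq_bigl => d; case: nc_ultrametricb => //=; lia.
have -> : \sum_(d : dist_matrix K n.+1 | nc_ultrametricb d && (dist d ord0 ord_max <= k.+1)%N
     && ~~ (dist d ord0 ord_max <= k)%N) exit_weight d =
   \sum_(d : dist_matrix K n.+1 | nc_ultrametricb d && (dist d ord0 ord_max == k.+1))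
     \sum_(a < n | cut k.+1 d a) exit_weight d.
  apply: eq_big => [d|d /andP[/andP[/nc_ultrametricP[h0 _ _ _] d1] d2]].
    by case: nc_ultrametricb => //=; lia.
  pose P z := (dist d ord0 z < k.+1)%N.
  have P0 : P ord0 by rewrite /P; have /eqP -> : (dist d ord0 ord0 == 0)%N by rewrite h0.
  case: (@arg_maxnP _ ord0 P val P0) => c Pc cmax.
  have cn : (c < n)%N.
    have := ltn_ord c; rewrite ltnS leq_eqVlt => /orP[/eqP cn|//].
    move: Pc d2; rewrite /P (_ : c = ord_max); last exact: val_inj.
    by rewrite ltnS => ->.
  rewrite (big_pred1 (Ordinal cn)) // => a; rewrite /cut /=.
  apply/andP/eqP => [[da /forallP ha]|->]; last first.
    split; first by rewrite inord_val.
    apply/forallP => z; apply/implyP => cz; rewrite leqNgt.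
    by apply: contraL cz => /cmax; rewrite /= -leqNgt.
  apply/val_inj/eqP; rewrite eqn_leq; apply/andP; split => /=.
    have := cmax _ da; rewrite /= inordK //; exact: ltn_trans (ltn_ord a) _.
  rewrite leqNgt; apply/negP => ac; have := ha c; rewrite ac /=.
  by rewrite leqNgt; move: Pc; rewrite /P => ->.
rewrite (exchange_big_dep predT) //= big_distrr; apply: eq_bigr => -[a an] _ /=.
have [b nE] : exists b, n = (a + b.+1)%N by exists (n - a.+1)%N; lia.
subst n; have -> : (a + b.+1 - a.+1 = b)%N by lia.
rewrite -(@cut_sum a b k.+1) //; apply: eq_bigl => d; rewrite andbA -andbA.
have e0 : (ord0 : 'I_(a + b.+1).+1) = lshift b.+1 (ord0 : 'I_a.+1) by apply: val_inj.
have e1 : (ord_max : 'I_(a + b.+1).+1) = rshift a.+1 (ord_max : 'I_b.+1).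
  by apply: val_inj; rewrite /= addSnnS.
have e2 : (inord a : 'I_(a + b.+1).+1) = lshift b.+1 (ord_max : 'I_a.+1).
  by apply: val_inj; rewrite /= inordK //; lia.
rewrite /cut /cut_at e0 e1 e2 andbA; congr (_ && _); congr (_ && _).
apply/forallP/forallP => h z.
  have := h (rshift a.+1 z : 'I_(a.+1 + b.+1)).
  by rewrite /= addSn ltnS leq_addr.
apply/implyP; case: (split_ordP (z : 'I_(a.+1 + b.+1))) => z' -> //=.
by have := ltn_ord z'; lia.
Qed.

End WeightedCount.

(** * Lukasiewicz words *)

(** s is the sequence of numbers of children, in depth-first order, of the nodes
    of an ordered forest with r trees. *)
Fixpoint luk (r : nat) (s : seq nat) : bool :=
  if s is d :: s' then (0 < r)%N && luk (r.-1 + d) s' else r == 0%N.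

Section Truncation.
Context (A : comNzRingType) (L : nat).
(** Equality of power series up to degree L. *)
Definition eqcoef (p q : {poly A}) := forall i, (i <= L)%N -> p`_i = q`_i.

Lemma eqcoefM p p' q q' : eqcoef p p' -> eqcoef q q' -> eqcoef (p * q) (p' * q').
Proof.
move=> pp qq i iL; rewrite !coefM; apply: eq_bigr => j _.
by rewrite pp ?qq // (leq_trans _ iL) ?leq_subr // -ltnS.
Qed.
End Truncation.

Section Luka.
Context (A : comNzRingType) (K : nat) (y : nat -> A).

Definition subset_weight (I : {set 'I_K}) : A := \prod_(i in I) y i.+1.

(** Weighted count of the forests with r trees and l nodes in which the children
    of a node are labelled by distinct colours. *)
Definition luk_sum (r l : nat) : A :=
  \sum_(t : l.-tuple {set 'I_K})
    (luk r [seq #|(J : {set 'I_K})| | J : {set 'I_K} <- t])%:R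
    * \prod_(a < l) subset_weight (tnth t a).

Lemma luk_sum0 r : luk_sum r 0 = (r == 0%N)%:R.
Proof.
rewrite /luk_sum (big_pred1 [tuple]) => [|t]; last exact/esym/eqP/tuple0.
by rewrite /= big_ord0 mulr1.
Qed.

Lemma luk_sumS r l : luk_sum r l.+1 =
  \sum_(I : {set 'I_K}) (0 < r)%N%:R * subset_weight I * luk_sum (r.-1 + #|I|) l.
Proof.
rewrite /luk_sum big_tuple_cons; apply: eq_bigr => I _.
rewrite big_distrr; apply: eq_bigr => t _ /=.
rewrite big_ord_recl /= (eq_bigr (fun a => subset_weight (tnth t a))); last first.
  by move=> a _; rewrite tnthS.
by case: (0 < r)%N; rewrite ?mulr1n ?mulr0n; ring.
Qed.

Lemma prod_one_plus (G : {poly A}) :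
  \prod_(i < K) (1 + y i.+1 *: G) =
  \sum_(I : {set 'I_K}) subset_weight I *: G ^+ #|I|.
Proof.
rewrite (eq_bigr (fun i : 'I_K => y i.+1 *: G + 1)) => [|i _]; last by rewrite addrC.
rewrite bigA_distr; apply: eq_bigr => I _.
rewrite -big_mkcond /subset_weight -prodr_const.
by rewrite scaler_prod.
Qed.

(** If G = z prod_k (1 + y_k G), then the forests with r trees are counted by
    G ^ r: remove the first node of the forest. *)
Lemma luk_sum_coef L (G : {poly A}) :
  eqcoef L G ('X * \prod_(i < K) (1 + y i.+1 *: G)) ->
  forall l r, (l <= L)%N -> luk_sum r l = (G ^+ r)`_l.
Proof.
move=> eG; elim=> [|l IH] r lL.
  have G0 : G`_0 = 0 by rewrite eG // coefXM.
  by rewrite luk_sum0 -horner_coef0 horner_exp horner_coef0 G0 expr0n.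
rewrite luk_sumS; case: r => [|r].
  by rewrite big1 ?expr0 ?coef1 // => I _; rewrite !mul0r.
rewrite exprSr (eqcoefM (p' := G ^+ r) _ eG) // mulrCA coefXM /=.
rewrite prod_one_plus big_distrr coef_sum; apply: eq_bigr => I _ /=.
by rewrite mul1r -scalerAr coefZ -exprD IH // ltnW.
Qed.

Lemma ultrametric_sum_luk n : y K.+1 = 1 -> ultrametric_sum K y K n = luk_sum 1 n.+1.
Proof.
(* G k is truncated at degree n + 1, and its constant coefficient is 0. *)
move=> yK; pose L := n.+1.
pose G k : {poly A} := \poly_(i < n.+2) (if i is j.+1 then ultrametric_sum K y k j else 0).
have GE k i : (i <= L)%N -> (G k)`_i = if i is j.+1 then ultrametric_sum K y k j else 0.
  by move=> iL; rewrite coef_poly ltnS iL.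
have GS k : (k < K)%N -> eqcoef L (G k.+1) (G k * (1 + y k.+1 *: G K)).
  move=> kK i iL; rewrite mulrDr mulr1 coefD -scalerAr coefZ !GE // coefM.
  case: i iL => [|i] iL.
    by rewrite big_ord1 !GE // mul0r mulr0 addr0.
  rewrite ultrametric_sumS //; congr (_ + _ * _).
  rewrite big_ord_recl GE // mul0r add0r big_ord_recr /=.
  rewrite /bump /= !GE ?subnn ?mulr0 ?addr0 //; try by move: iL; rewrite /L; lia.
  apply: eq_bigr => j _; rewrite !GE; first last.
  - by move: iL (ltn_ord j); rewrite /L; lia.
  - by move: iL (ltn_ord j); rewrite /L; lia.
  have -> : (i.+1 - (1 + j) = (i - j.+1).+1)%N by move: (ltn_ord j); lia.
  by [].
have GP k : (k <= K)%N -> eqcoef L (G k) ('X * \prod_(i < k) (1 + y i.+1 *: G K)).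
  elim: k => [|k IH] kK i iL.
    rewrite big_ord0 mulr1 GE // coefX; case: i iL => // i _.
    by rewrite ultrametric_sum0.
  rewrite GS // big_ord_recr mulrA; by apply: (eqcoefM (IH (ltnW kK)) _ iL).
rewrite (luk_sum_coef (GP K (leqnn K))) // expr1 GE //.
Qed.

End Luka.

Section Transpose.
Context (A : comNzRingType) (N : nat).

(** The numbers of occurrences in w of the successive letters form a Lukasiewicz
    word; for N = n + 1 these are the parking functions of length n, the last
    letter never occurring. *)
Definition luk_word (w : seq 'I_N) : bool :=
  luk 1 [seq count_mem a w | a : 'I_N <- enum 'I_N].

Lemma count_flatten_enum K (S : K.-tuple {set 'I_N}) (a : 'I_N) :
  count_mem a (flatten [seq enum (B : {set 'I_N}) | B : {set 'I_N} <- S]) =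
  #|[set i | a \in tnth S i]|.
Proof.
rewrite count_flatten -map_comp sumnE big_map big_tuple.
rewrite -sum1_card big_mkcond /= [RHS]big_mkcond; apply: eq_bigr => i _.
rewrite inE count_uniq_mem ?enum_uniq // mem_enum.
by case: ifP.
Qed.

(** A set of colours for each letter amounts to a set of letters for each
    colour. *)
Lemma luk_sum_transpose K (y : nat -> A) :
  luk_sum K y 1 N = \sum_(S : K.-tuple {set 'I_N})
    (\prod_(i < K) y i.+1 ^+ #|tnth S i|)
    * (luk_word (flatten [seq enum (B : {set 'I_N}) | B : {set 'I_N} <- S]))%:R.
Proof.
pose tr m n (S : m.-tuple {set 'I_n}) : n.-tuple {set 'I_m} :=
  [tuple [set i | a \in tnth S i] | a < n].
have trK m n : cancel (@tr m n) (@tr n m).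
  move=> S; apply: eq_from_tnth => i; rewrite tnth_mktuple.
  by apply/setP => a; rewrite inE tnth_mktuple inE.
rewrite /luk_sum (reindex (@tr K N)) /=; last first.
  by exists (@tr N K) => S _; apply: trK.
apply: eq_bigr => S _; rewrite mulrC; congr (_ * _%:R).
  rewrite /subset_weight (eq_bigr (fun a => \prod_(i < K | a \in tnth S i) y i.+1)).
    rewrite (exchange_big_dep predT) //=; apply: eq_bigr => i _.
    by rewrite prodr_const.
  by move=> a _; rewrite tnth_mktuple; apply: eq_bigl => i; rewrite inE.
rewrite /luk_word; congr (nat_of_bool (luk 1 _)).
rewrite -map_comp; apply: eq_map => a /=.
by rewrite count_flatten_enum.
Qed.
End Transpose.

(** * Noncrossing blocks on the circle *)

Section Geometry.
Context (R : realType) (N : nat).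
Implicit Types (i j k : 'I_N) (A B : {set 'I_N}).

Definition angle (i : 'I_N) : R := 2 * trigo.pi * i%:R / N%:R.
Local Notation vertex := (@polygon_vertex R N).

(** Half the length of the chord from vertex i to vertex j, counted negatively
    if j < i. *)
Definition chord_sin i j : R := sin ((angle j - angle i) / 2).

Lemma chord_sin_gt0 i j : (i < j)%N -> 0 < chord_sin i j.
Proof.
move=> ij; have N0 : 0 < N%:R :> R by rewrite ltr0n (leq_ltn_trans (leq0n i)).
rewrite /chord_sin /angle.
have -> : (2 * trigo.pi * j%:R / N%:R - 2 * trigo.pi * i%:R / N%:R) / 2 =
    trigo.pi * ((j - i)%:R / N%:R) :> R.
  by rewrite natrB 1?ltnW//; field; rewrite gt_eqF.
apply: sin_gt0_pi; rewrite mulr_gt0 ?pi_gt0 ?divr_gt0 ?ltr0n ?subn_gt0//=; last first.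
  exact: leq_ltn_trans (ltn_ord i).
rewrite gtr_pMr ?pi_gt0// ltr_pdivrMr// mul1r ltr_nat.
by rewrite (leq_ltn_trans (leq_subr _ _)).
Qed.

Lemma chord_sinC i j : chord_sin j i = - chord_sin i j.
Proof. by rewrite /chord_sin -sinN; congr sin; ring. Qed.

Lemma chord_sin_ge0 i j : (i <= j)%N -> 0 <= chord_sin i j.
Proof.
rewrite leq_eqVlt => /orP[/eqP/val_inj->|/chord_sin_gt0/ltW//].
by rewrite /chord_sin subrr mul0r sin0.
Qed.

(** Twice the area of the triangle with vertices i, j, k, signed so as to be
    positive when i < j < k. *)
Definition area i j k : R :=
  sin (angle j - angle i) + sin (angle k - angle j) - sin (angle k - angle i).

Lemma area_gt0 i j k : (i < j)%N -> (j < k)%N -> 0 < area i j k.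
Proof.
move=> ij jk.
suff -> : area i j k = 4 * chord_sin i j * chord_sin j k * chord_sin i k.
  rewrite !mulr_gt0 ?chord_sin_gt0 //; exact: ltn_trans jk.
rewrite /area /chord_sin.
set a := (angle j - angle i) / 2; set b := (angle k - angle j) / 2.
have -> : angle j - angle i = a *+ 2 by rewrite /a; field.
have -> : angle k - angle j = b *+ 2 by rewrite /b; field.
have -> : angle k - angle i = (a + b) *+ 2 by rewrite /a /b; field.
have -> : (a + b) *+ 2 / 2 = a + b by field.
rewrite !sin_mulr2n sinD cosD.
have /eqP := cos2Dsin2 a; have /eqP := cos2Dsin2 b.
rewrite -subr_eq0 => /eqP hb; rewrite -subr_eq0 => /eqP ha.
apply/eqP; rewrite -subr_eq0; apply/eqP.
transitivity (- 2 * sin a * cos a * (cos b ^+ 2 + sin b ^+ 2 - 1)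
              - 2 * sin b * cos b * (cos a ^+ 2 + sin a ^+ 2 - 1)); first by ring.
by rewrite ha hb; ring.
Qed.

(** The affine dependency between four points of the plane. *)
Lemma vertex_dependency i j k l :
  area j k l *: vertex i + area i j l *: vertex k =
  area i k l *: vertex j + area i j k *: vertex l.
Proof.
apply/rowP => m; rewrite !mxE; have [->|->] : m = 0 \/ m = 1.
- case: m => [[|[|?]] h] //; [left|right]; exact: val_inj.
- by rewrite /area !sinB -!/(angle _) /=; ring.
by rewrite /area !sinB -!/(angle _) /=; ring.
Qed.

Lemma area_additive i j k l : area j k l + area i j l = area i k l + area i j k.
Proof. by rewrite /area; ring. Qed.

Lemma vertex_hull_conv A i k (l : R) : i \in A -> k \in A -> 0 <= l -> l <= 1 ->
  (vertex_hull (R := R) A (l *: vertex i + (1 - l) *: vertex k))%classic.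
Proof.
move=> iA kA l0 l1 C [cC AC].
have := cC (vertex i) (vertex k) (Itv01 l0 l1).
rewrite !in_setE; apply; apply: AC; rewrite /=; [by exists i|by exists k].
Qed.

(** The diagonals of a convex quadrilateral meet, at the point given by the
    affine dependency of the vertices. *)
Lemma crossing_hulls A B i j k (l : 'I_N) : (i < j)%N -> (j < k)%N -> (k < l)%N ->
  i \in A -> k \in A -> j \in B -> l \in B ->
  (vertex_hull (R := R) A `&` vertex_hull (R := R) B !=set0)%classic.
Proof.
move=> ij jk kl iA kA jB lB.
have jl := ltn_trans jk kl; have ik := ltn_trans ij jk.
pose T := area j k l + area i j l.
have p1 := area_gt0 jk kl; have p2 := area_gt0 ij jl.
have p3 := area_gt0 ik kl; have p4 := area_gt0 ij jk.
have T0 : 0 < T by rewrite addr_gt0.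
have TE : T = area i k l + area i j k by exact: area_additive.
have e1 : 1 - area j k l / T = area i j l / T.
  by rewrite -[X in X - _](divff (lt0r_neq0 T0)) -mulrBl; congr (_ / _); rewrite /T; ring.
have e2 : 1 - area i k l / T = area i j k / T.
  by rewrite -[X in X - _](divff (lt0r_neq0 T0)) -mulrBl; congr (_ / _); rewrite TE; ring.
exists (area j k l / T *: vertex i + (1 - area j k l / T) *: vertex k); split.
  apply: vertex_hull_conv => //; first by rewrite divr_ge0 // ltW.
  by rewrite -subr_ge0 e1 divr_ge0 // ltW.
have -> : area j k l / T *: vertex i + (1 - area j k l / T) *: vertex k =
    area i k l / T *: vertex j + (1 - area i k l / T) *: vertex l.
  rewrite e1 e2 ![_ / T]mulrC -!scalerA -!scalerDr; congr (_ *: _).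
  exact: vertex_dependency.
apply: vertex_hull_conv => //; first by rewrite divr_ge0 // ltW.
by rewrite -subr_ge0 e2 divr_ge0 // ltW.
Qed.

(** The linear form measuring the height of v in the direction of the point of
    angle f on the (clockwise) circle. *)
Definition halfplane_form (f : R) (v : 'rV[R]_2) : R := cos f * v 0 0 - sin f * v 0 1.

Lemma halfplane_conv (f : R) (P : R -> Prop) :
  (forall x y l, 0 <= l -> l <= 1 -> P x -> P y -> P (l * x + (1 - l) * y)) ->
  @convex_set R 'rV[R]_2 [set v | P (halfplane_form f v)]%classic.
Proof.
move=> cP x y l; rewrite !in_setE => Px Py /=.
have -> : halfplane_form f (conv l x y) =
    l%:num * halfplane_form f x + (1 - l%:num) * halfplane_form f y.
  by rewrite /halfplane_form !mxE /=; rewrite /unstable.onem; ring.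
by apply: cP; rewrite ?ge0 ?le1.
Qed.

(** The height of vertex k above the chord from i to j, in product form; its sign
    says on which of the two arcs the vertex k lies. *)
Lemma form_vertex i j k : let f := (angle i + angle j) / 2 in
  halfplane_form f (vertex k) - cos ((angle j - angle i) / 2) =
  2 * chord_sin k j * chord_sin i k.
Proof.
rewrite /halfplane_form !mxE /= -/(angle k) /chord_sin.
set a := (angle j - angle k) / 2; set b := (angle k - angle i) / 2.
set f := (_ + _) / 2.
have -> : cos f * cos (angle k) - sin f * - sin (angle k) = cos (f - angle k).
  by rewrite cosB; ring.
have -> : f - angle k = a - b by rewrite /f /a /b; field.
have -> : (angle j - angle i) / 2 = a + b by rewrite /a /b; field.
by rewrite cosB cosD; ring.
Qed.

(** The chord from i to j separates the vertices of the arc from i to j from all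
    the others. *)
Lemma separated_hulls A B i j :
  (forall k, k \in B -> (i <= k <= j)%N) ->
  (i <= j)%N -> (forall k, k \in A -> (k < i)%N || (j < k)%N) ->
  (vertex_hull A `&` vertex_hull B = classical_sets.set0 :> set 'rV[R]_2)%classic.
Proof.
move=> hB ij hA; pose f := (angle i + angle j) / 2.
pose c := cos ((angle j - angle i) / 2).
have sA : (vertex_hull A `<=` [set v : 'rV[R]_2 | halfplane_form f v < c])%classic.
  apply: smallest_sub.
    apply: (@halfplane_conv f (fun z => z < c)) => x y l l0 l1 xc yc.
    have [->|l1'] := eqVneq l 1; first by rewrite subrr mul0r addr0 mul1r.
    have : (1 - l) * y < (1 - l) * c by rewrite ltr_pM2l // subr_gt0 lt_neqAle l1'.
    have : l * x <= l * c by rewrite ler_wpM2l // ltW.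
    lra.
  move=> _ [k /= kA <-]; rewrite -subr_lt0 form_vertex.
  case/orP: (hA k kA) => h.
    rewrite (chord_sinC k i) mulrN oppr_lt0 !mulr_gt0 ?chord_sin_gt0 //.
    exact: leq_trans ij.
  rewrite (chord_sinC j k) mulrN mulNr oppr_lt0 !mulr_gt0 ?chord_sin_gt0 //.
  exact: leq_ltn_trans h.
have sB : (vertex_hull B `<=` [set v : 'rV[R]_2 | c <= halfplane_form f v])%classic.
  apply: smallest_sub.
    apply: (@halfplane_conv f (fun z => c <= z)) => x y l l0 l1 xc yc.
    have : (1 - l) * c <= (1 - l) * y by rewrite ler_wpM2l // subr_ge0.
    have : l * c <= l * x by rewrite ler_wpM2l.
    lra.
  move=> _ [k /= /hB /andP[h1 h2] <-]; rewrite -subr_ge0 form_vertex.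
  by rewrite !mulr_ge0 ?chord_sin_ge0.
rewrite -classical_sets.subset0 => v [/sA /= h1 /sB /= h2].
by have := lt_le_trans h1 h2; rewrite ltxx.
Qed.

(** Noncrossing in combinatorial terms: no i < j < k < l with i, k in one block
    and j, l in another one. *)
Definition crossing_free (pi : {set {set 'I_N}}) : Prop :=
  forall A B, A \in pi -> B \in pi -> A != B ->
  forall i j k l : 'I_N, (i < j)%N -> (j < k)%N -> (k < l)%N ->
    i \in A -> k \in A -> j \in B -> l \in B -> False.

Lemma noncrossingP (pi : {set {set 'I_N}}) :
  partition pi [set: 'I_N] ->
  noncrossing R pi <-> crossing_free pi.
Proof.
move=> /and3P[_ /trivIsetP tr p0]; split.
  move=> nc A B Api Bpi AB i j k l ij jk kl iA kA jB lB.
  have /classical_sets.set0P := crossing_hulls ij jk kl iA kA jB lB.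
  by rewrite nc ?eqxx.
move=> cf.
have key A B i0 : A \in pi -> B \in pi -> A != B -> i0 \in A ->
    (forall k, k \in B -> (i0 < k)%N) ->
    (vertex_hull A `&` vertex_hull B = classical_sets.set0 :> set 'rV[R]_2)%classic.
  move=> Api Bpi AB i0A i0B.
  (* If A starts before B, it has no point between the first and last points of
     B, so the chord joining those separates B from A. *)
  have dAB : forall k, k \in A -> k \in B -> False.
    move=> k kA kB; have := tr _ _ Api Bpi AB.
    by rewrite disjoints_subset => /subsetP/(_ _ kA); rewrite inE kB.
  have /set0Pn[b bB] : B != set0 by apply: contraNneq p0 => <-.
  case: (@arg_minnP _ b (mem B) val bB) => i iB imin.
  case: (@arg_maxnP _ b (mem B) val bB) => j jB jmax.
  apply: (@separated_hulls _ _ i j); last 1 first.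
  - move=> k kA; rewrite !ltnNge -negb_and; apply/negP => /andP[ik kj].
    have ik' : (i < k)%N.
      by rewrite ltn_neqAle ik andbT; apply/eqP => /val_inj e; apply: (dAB k) => //; rewrite -e.
    have kj' : (k < j)%N.
      by rewrite ltn_neqAle kj andbT; apply/eqP => /val_inj e; apply: (dAB k) => //; rewrite e.
    exact: (cf A B Api Bpi AB i0 i k j (i0B _ iB) ik' kj').
  - by move=> k kB; apply/andP; split; [apply: imin|apply: jmax].
  - exact: imin.
move=> A B Api Bpi AB.
have /set0Pn[a aA] : A != set0 by apply: contraNneq p0 => <-.
have /set0Pn[b bB] : B != set0 by apply: contraNneq p0 => <-.
case: (@arg_minnP _ a (mem A) val aA) => i iA imin.
case: (@arg_minnP _ b (mem B) val bB) => j jB jmin.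
case: (ltngtP i j) => ij.
- apply: (key A B i) => // k kB; exact: leq_trans ij (jmin _ kB).
- rewrite classical_sets.setIC; apply: (key B A j) => //; first by rewrite eq_sym.
  by move=> k kA; apply: leq_trans ij (imin _ kA).
- have := tr _ _ Api Bpi AB; rewrite disjoints_subset.
  by move=> /subsetP/(_ _ iA); rewrite inE (val_inj ij) (jB : j \in B).
Qed.

End Geometry.

(** * Multichains of noncrossing partitions *)

Section NCRel.
Context (R : realType) (N : nat).
Implicit Types (p q : NC R N) (x y z : 'I_N) (e : rel 'I_N).

(** x and y lie in the same block of p. *)
Definition nc_rel p : rel 'I_N := fun x y => y \in pblock (nc_blocks p) x.

Lemma mem_cover p x : x \in cover (nc_blocks p).
Proof. by rewrite (cover_partition (nc_partition p)) inE. Qed.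

Lemma nc_triv p : trivIset (nc_blocks p).
Proof. by have /and3P[] := nc_partition p. Qed.

Lemma nc_rel_sub p x y : nc_rel p x y -> pblock p x = pblock p y.
Proof. by move=> xy; rewrite (same_pblock (nc_triv p) xy). Qed.

Lemma nc_rel_refl p : reflexive (nc_rel p).
Proof. by move=> x; rewrite /nc_rel mem_pblock mem_cover. Qed.

Lemma nc_relC p : symmetric (nc_rel p).
Proof.
suff h x y : nc_rel p x y -> nc_rel p y x by move=> x y; apply/idP/idP; apply: h.
by move=> xy; rewrite /nc_rel -(nc_rel_sub xy) mem_pblock mem_cover.
Qed.

Lemma nc_relT p : transitive (nc_rel p).
Proof. by move=> y x z xy; rewrite /nc_rel (nc_rel_sub xy). Qed.

Lemma nc_rel_cross p (i j k l : 'I_N) : (i < j)%N -> (j < k)%N -> (k < l)%N ->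
  nc_rel p i k -> nc_rel p j l -> nc_rel p i j.
Proof.
move=> ij jk kl ik jl; case: (boolP (nc_rel p i j)) => // nij; exfalso.
have cf : crossing_free (nc_blocks p).
  apply/(@noncrossingP R) => //; first exact: nc_partition.
  by case: p {ik jl nij} => /= pi /andP[_ /asboolP].
apply: (cf (pblock p i) (pblock p j) _ _ _ i j k l) => //.
- by rewrite pblock_mem // mem_cover.
- by rewrite pblock_mem // mem_cover.
- by apply: contra nij => /eqP e; rewrite /nc_rel e; apply: nc_rel_refl.
- exact: nc_rel_refl.
- exact: nc_rel_refl.
Qed.

Lemma nc_le_rel p q :
  reflect (forall x y, nc_rel p x y -> nc_rel q x y) (p <= q)%O.
Proof.
apply: (iffP (nc_leP p q)) => [h x y xy|h B Bp].
  have [C Cq BC] := h (pblock p x) (pblock_mem (mem_cover p x)).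
  have xC : x \in C by apply: (subsetP BC); apply: nc_rel_refl.
  have yC : y \in C by apply: (subsetP BC).
  by rewrite /nc_rel (def_pblock (nc_triv q) Cq xC).
have /set0Pn[x xB] : B != set0.
  by have /and3P[_ _] := nc_partition p; apply: contraNneq => <-.
exists (pblock q x); first by rewrite pblock_mem // mem_cover.
apply/subsetP => y yB; apply: h.
by rewrite /nc_rel (def_pblock (nc_triv p) Bp xB).
Qed.

Lemma nc_rel_inj p q : nc_rel p =2 nc_rel q -> p = q.
Proof.
by move=> h; apply/le_anti/andP; split; apply/nc_le_rel => x y; rewrite h.
Qed.

Lemma nc_rel_bot x y : nc_rel (\bot%O : NC R N) x y = (x == y).
Proof.
rewrite /nc_rel (@def_pblock _ _ [set x] x).
- by rewrite inE eq_sym.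
- exact: nc_triv.
- exact: imset_f.
- exact: set11.
Qed.

Definition nc_set e := equivalence_partition e [set: 'I_N].

(** The noncrossing partition into classes of e, with the finest partition as a
    default value when e does not define one. *)
Definition nc_of e : NC R N := insubd (\bot%O : NC R N) (nc_set e).

Lemma nc_ofE e : reflexive e -> symmetric e -> transitive e ->
  (forall i j k l : 'I_N, (i < j)%N -> (j < k)%N -> (k < l)%N ->
    e i k -> e j l -> e i j) ->
  nc_rel (nc_of e) =2 e.
Proof.
move=> er es et ex.
have ee : {in [set: 'I_N] & &, equivalence_rel e}.
  move=> x y z _ _ _; split=> // xy; apply/idP/idP; apply: et => //.
  by rewrite es.
have pe : partition (nc_set e) [set: 'I_N].
  exact: equivalence_partitionP.
have H : nc_blocks (nc_of e) = nc_set e.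
  apply: insubdK; rewrite -topredE /= pe /=; apply/asboolP.
  apply/noncrossingP => // A B /imsetP[a _ ->] /imsetP[b _ ->] AB i j k l ij jk kl.
  rewrite !inE /= => ai ak bj bl.
  have ik : e i k by apply: et ak; rewrite es.
  have jl : e j l by apply: et bl; rewrite es.
  have eij := ex _ _ _ _ ij jk kl ik jl.
  case/eqP: AB; apply/setP => z; rewrite !inE /=.
  have ab : e a b by apply: et ai (et _ _ _ eij _); rewrite es.
  by apply/idP/idP; apply: et => //; rewrite es.
move=> x y; rewrite /nc_rel H /nc_set.
by rewrite pblock_equivalence_partition ?inE.
Qed.

(** The blocks correspond to their last points, so the rank counts the points
    that are not the last of their block. *)
Lemma nc_rankE p :
  nc_rank p = #|[set x : 'I_N | [exists y : 'I_N, (x < y)%N && nc_rel p x y]]|.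
Proof.
rewrite /nc_rank; set S := finset _.
suff -> : #|nc_blocks p| = #|setC S| by rewrite [RHS]cardsCs card_ord.
have inj : {in setC S &, injective (pblock (nc_blocks p))}.
  move=> x y; rewrite !inE => /existsPn hx /existsPn hy e.
  have xy : nc_rel p x y by rewrite /nc_rel e; apply: nc_rel_refl.
  have := hx y; have := hy x; rewrite xy nc_relC xy !andbT => yx xy'.
  by apply/val_inj/eqP; rewrite eqn_leq leqNgt yx leqNgt xy'.
rewrite -(card_in_imset inj); apply: eq_card => B; apply/idP/imsetP => [Bp|[x _ ->]].
  have /set0Pn[x xB] : B != set0.
    by have /and3P[_ _] := nc_partition p; apply: contraNneq => <-.
  case: (@arg_maxnP _ x (mem B) val xB) => c cB cmax.
  have eB : pblock p c = B by apply: def_pblock => //; apply: nc_triv.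
  exists c => //; rewrite !inE; apply/existsPn => z; apply/negP => /andP[cz].
  by rewrite /nc_rel eB => /cmax /=; rewrite leqNgt cz.
by rewrite pblock_mem // mem_cover.
Qed.

End NCRel.

Section Multichains.
Context (R : realType) (n m : nat).
Local Notation N := n.+1.
Local Notation P := (NC R N).
Local Notation K := m.+1.
Implicit Types (t : m.-tuple P) (d : dist_matrix K N).

(** The element p_j of the multichain, with p_0 the minimum. *)
Definition chain_step t j : P := nth \bot%O (\bot%O :: t) j.

(** The least j such that x and y lie in the same block of p_j, and m + 1 if there
    is none. *)
Definition dist_of t : dist_matrix K N :=
  [ffun xy => inord (find (fun q : P => nc_rel q xy.1 xy.2) (\bot%O :: t))].

(** The partitions into balls of radius 1, ..., m. *)
Definition chain_of d : m.-tuple P :=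
  [tuple nc_of R (fun x y => (dist d x y <= (i : 'I_m).+1)%N) | i < m].

Lemma dist_ofE t x y :
  dist (dist_of t) x y = find (fun q : P => nc_rel q x y) (\bot%O :: t).
Proof.
rewrite /dist ffunE inordK // ltnS (leq_trans (find_size _ _)) //=.
by rewrite size_tuple.
Qed.

Lemma dist_of_le t j x y : path <=%O \bot%O t -> (j <= m)%N ->
  (dist (dist_of t) x y <= j)%N = nc_rel (chain_step t j) x y.
Proof.
move=> ct jm; rewrite dist_ofE; set a := fun q : P => _.
have sz : size ((\bot%O : P) :: t) = K by rewrite /= size_tuple.
apply/idP/idP => [fj|rj]; last first.
  rewrite leqNgt; apply/negP => /(before_find (\bot%O : P)).
  by rewrite /a -/(chain_step t j) rj.
have hs : has a (\bot%O :: t) by rewrite has_find sz (leq_ltn_trans fj).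
have := nth_find (\bot%O : P) hs; rewrite {1}/a.
have : (chain_step t (find a (\bot%O :: t)) <= chain_step t j)%O.
  apply: (sorted_leq_nth le_trans le_refl (\bot%O : P) (s := \bot%O :: t)) => //;
    by rewrite inE sz // (leq_ltn_trans fj).
by move=> /nc_le_rel; apply.
Qed.

(** Distances are compared through the radii 0, ..., m only. *)
Lemma leq_levels (d d' : nat) : (d' <= K)%N ->
  (forall j, (j <= m)%N -> (d <= j)%N -> (d' <= j)%N) ->
  (d' <= d)%N.
Proof.
move=> d'K h; case: (leqP d m) => [dm|md]; first exact: h.
exact: leq_trans d'K md.
Qed.

Lemma dist_leK N' (d : dist_matrix K N') x y : (dist d x y <= K)%N.
Proof. by rewrite -ltnS ltn_ord. Qed.

Lemma dist_of_ultrametric t : path <=%O \bot%O t -> nc_ultrametric (dist (dist_of t)).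
Proof.
move=> ct; split.
- by move=> x y; rewrite -leqn0 dist_of_le // nc_rel_bot.
- suff h x y : (dist (dist_of t) x y <= dist (dist_of t) y x)%N.
    by move=> x y; apply/eqP; rewrite eqn_leq !h.
  by apply: leq_levels; rewrite ?dist_leK // => j jm; rewrite !dist_of_le // nc_relC.
- move=> x y z; apply: leq_levels; rewrite ?dist_leK // => j jm.
  rewrite geq_max !dist_of_le // => /andP[]; exact: nc_relT.
- move=> i j k l ij jk kl; apply: leq_levels; rewrite ?dist_leK // => h hm.
  rewrite geq_max !dist_of_le // => /andP[]; exact: nc_rel_cross kl.
Qed.

Lemma chain_step_chain_of d j : nc_ultrametric (dist d) -> (j <= m)%N ->
  nc_rel (chain_step (chain_of d) j) =2 (fun x y => (dist d x y <= j)%N).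
Proof.
case=> h0 hC hT hX; case: j => [|j] jm x y.
  by rewrite nc_rel_bot leqn0 h0.
rewrite /chain_step /= (nth_mktuple _ _ (Ordinal jm)).
rewrite nc_ofE //=.
- by move=> z; have /eqP -> : (dist d z z == 0)%N by rewrite h0.
- by move=> u v; rewrite hC.
- by move=> u v w; have := hT v u w; lia.
- by move=> a b c e ab bc ce; have := hX _ _ _ _ ab bc ce; lia.
Qed.

Lemma chain_of_path d : nc_ultrametric (dist d) -> path <=%O \bot%O (chain_of d).
Proof.
move=> nd; apply/(pathP (\bot%O : P)) => i; rewrite size_tuple => im.
apply/nc_le_rel => x y.
rewrite -/(chain_step (chain_of d) i) -[nth _ _ i]/(chain_step (chain_of d) i.+1).
by rewrite !chain_step_chain_of ?(ltnW im) //; apply: leqW.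
Qed.

Lemma dist_ofK d : nc_ultrametric (dist d) -> dist_of (chain_of d) = d.
Proof.
move=> nd; apply/ffunP => -[x y]; apply/val_inj/eqP.
rewrite -[val (dist_of _ _)]/(dist (dist_of (chain_of d)) x y) -[val (d _)]/(dist d x y).
rewrite eqn_leq; apply/andP; split; apply: leq_levels; rewrite ?dist_leK // => j jm.
  by rewrite dist_of_le ?chain_of_path // chain_step_chain_of.
by rewrite dist_of_le ?chain_of_path // chain_step_chain_of.
Qed.

Lemma chain_ofK t : path <=%O \bot%O t -> chain_of (dist_of t) = t.
Proof.
move=> ct; apply: eq_from_tnth => i; apply: nc_rel_inj => x y.
have tE u : tnth u i = chain_step u i.+1 by rewrite /chain_step /= (tnth_nth \bot%O).
by rewrite !tE chain_step_chain_of ?dist_of_le //; apply: dist_of_ultrametric.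
Qed.

Lemma big_multichain (A : nmodType) (F : m.-tuple P -> A) :
  \sum_(t : m.-tuple P | path <=%O \bot%O t) F t =
  \sum_(d : dist_matrix K N | nc_ultrametricb d) F (chain_of d).
Proof.
rewrite (reindex_onto chain_of dist_of); last exact: chain_ofK.
apply: eq_bigl => d; apply/andP/nc_ultrametricP => [[ct /eqP <-]|nd].
  exact: dist_of_ultrametric.
by rewrite chain_of_path // dist_ofK.
Qed.

Lemma rank_chain_step d j : nc_ultrametric (dist d) -> (j <= m)%N ->
  nc_rank (chain_step (chain_of d) j) = #|[set x | exit_level d x <= j]%N|.
Proof.
move=> nd jm; rewrite nc_rankE; apply: eq_card => x; rewrite !inE exit_level_le ltnNge leqW //=.
by apply: eq_existsb => y; rewrite chain_step_chain_of.
Qed.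

(** The rank jumps of a multichain are the numbers of points at each exit
    level. *)
Lemma rank_jump d (i : 'I_m) : nc_ultrametric (dist d) ->
  (nc_rank (tnth (chain_of d) i) - nc_rank (nth \bot%O (\bot%O :: chain_of d) i))%N
  = #|[set x | exit_level d x == i.+1]|.
Proof.
move=> nd; have -> : tnth (chain_of d) i = chain_step (chain_of d) i.+1.
  by rewrite /chain_step /= (tnth_nth \bot%O).
rewrite -/(chain_step _ i) !rank_chain_step // 1?ltnW //.
have -> : [set x | (exit_level d x <= i.+1)%N] =
    setU [set x | (exit_level d x <= i)%N] [set x | exit_level d x == i.+1].
  by apply/setP => x; rewrite !inE leq_eqVlt orbC ltnS.
rewrite cardsU (_ : setI _ _ = set0) ?cards0 ?subn0 ?addKn //.
apply/setP => x; rewrite !inE; apply/negbTE/negP => /andP[h /eqP e].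
by rewrite e ltnn in h.
Qed.

End Multichains.

(** * Polarization of the weights *)

Section Polarization.
Context (A : idomainType) (x : A) (w : nat -> A) (m : nat).
Context (x1 : 1 - x != 0).
Context (wE : forall k, (1 - x) * w k = x - x ^+ k + (1 - x) * 0 ^+ k).

Let pt (j : 'I_3) : A := nth 0 [:: 1; x; 0] j.
Let cf (j : 'I_3) : A := nth 0 [:: x; -1; 1 - x] j.

(** Up to the factor (1 - x) ^ m, a product of m weights w is a combination of
    products of m powers of x, 1 and 0. *)
Lemma weight_expand (X : finType) (Q : pred X) (v : X -> A) (s : X -> 'I_m -> nat) :
  (1 - x) ^+ m * (\sum_(c | Q c) v c * \prod_(i < m) w (s c i)) =
  \sum_(phi : {ffun 'I_m -> 'I_3}) (\prod_i cf (phi i)) *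
     \sum_(c | Q c) v c * \prod_(i < m) pt (phi i) ^+ s c i.
Proof.
under [RHS]eq_bigr do rewrite big_distrr /=.
rewrite exchange_big big_distrr /=; apply: eq_bigr => c _.
under [RHS]eq_bigr do rewrite mulrCA -big_split /=.
rewrite -big_distrr mulrCA; congr (_ * _).
rewrite -{1}[m]card_ord -prodr_const -big_split /=.
rewrite -(bigA_distr_bigA (fun i j => cf j * pt j ^+ s c i)).
apply: eq_bigr => i _; rewrite wE !big_ord_recl big_ord0 /cf /pt /= expr1n.
by ring.
Qed.

(** Two families of objects with the same joint distribution of statistics, as
    seen by the weights y_i ^ s_i, have the same sum for the weight w. *)
Lemma polarization (X X' : finType) (Q : pred X) (Q' : pred X') (v : X -> A) (v' : X' -> A)
    (s : X -> 'I_m -> nat) (s' : X' -> 'I_m -> nat) :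
  (forall y : 'I_m -> A, \sum_(c | Q c) v c * \prod_(i < m) y i ^+ s c i =
                         \sum_(c | Q' c) v' c * \prod_(i < m) y i ^+ s' c i) ->
  \sum_(c | Q c) v c * \prod_(i < m) w (s c i) =
  \sum_(c | Q' c) v' c * \prod_(i < m) w (s' c i).
Proof.
move=> h; apply: (mulfI (expf_neq0 m x1)); rewrite !weight_expand.
by apply: eq_bigr => phi _; rewrite (h (pt \o phi)).
Qed.

End Polarization.

(** The joint distribution of the rank jumps over multichains equals that of the
    block sizes over the tuples of m + 1 sets of letters whose concatenation is
    parking; the last set, like the last rank jump, carries no weight. *)
Lemma ultrametric_count (A : comNzRingType) (n m : nat) (y : 'I_m -> A) :
  \sum_(d : dist_matrix m.+1 n.+1 | nc_ultrametricb d)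
     \prod_(i < m) y i ^+ #|[set a | exit_level d a == i.+1]| =
  \sum_(S : m.+1.-tuple {set 'I_n.+1})
     (luk_word (flatten [seq enum (B : {set 'I_n.+1}) | B : {set 'I_n.+1} <- S]))%:R
     * \prod_(i < m) y i ^+ #|tnth S (widen_ord (leqnSn m) i)|.
Proof.
(* Colour i + 1 gets y_i; colour m + 1, for the last jump, and the exit level
   m + 2 of the last point get 1. *)
pose y' j := \prod_(i < m) (if j == i.+1 then y i else 1).
have y'S (i : 'I_m) : y' i.+1 = y i.
  rewrite /y' (bigD1 i) //= eqxx big1 ?mulr1 // => j ji.
  by rewrite eqSS eq_sym (inj_eq val_inj) (negPf ji).
have y'1 j : (m < j)%N -> y' j = 1.
  move=> mj; apply: big1 => i _; rewrite gtn_eqF //.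
  exact: leq_ltn_trans (ltn_ord i) mj.
transitivity (ultrametric_sum m.+1 y' m.+1 n).
  apply: eq_big => [d|d _]; first by rewrite dist_leK andbT.
  rewrite /exit_weight exchange_big /=; apply: eq_bigr => i _.
  rewrite -big_mkcond prodr_const; congr (_ ^+ _).
  by apply: eq_card => a; rewrite inE.
rewrite ultrametric_sum_luk ?y'1 // luk_sum_transpose; apply: eq_bigr => S _.
rewrite mulrC big_ord_recr /= y'1 // expr1n mulr1; congr (_ * _).
by apply: eq_bigr => i _; rewrite y'S.
Qed.

(** * Parking functions as Lukasiewicz words *)

Section Parking.
Context (n : nat).

(** A Lukasiewicz word satisfies a ballot condition on its partial sums. *)
Lemma lukE r s : luk r s =
  all (fun k => (k < r + sumn (take k s))%N) (iota 0 (size s)) && (r + sumn s == size s)%N.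
Proof.
elim: s r => [|d s IH] r /=; first by rewrite addn0.
case: r => [|r] //=; rewrite IH; congr (_ && _); last by rewrite addSn eqSS addnA.
rewrite -[1%N]addn0 iotaDl all_map; apply: eq_all => k /=.
by rewrite add1n addSn ltnS addnA.
Qed.

Lemma sumn_take_count N (w : seq 'I_N) k :
  sumn (take k [seq count_mem a w | a : 'I_N <- enum 'I_N]) = count (fun a : 'I_N => (a < k)%N) w.
Proof.
rewrite -map_take sumnE big_map -sum1_count.
under eq_bigr do rewrite -sum1_count big_mkcond.
rewrite exchange_big [RHS]big_mkcond; apply: eq_bigr => b _ /=.
rewrite -big_mkcond sum1_count; under eq_count do rewrite eq_sym.
rewrite count_uniq_mem ?take_uniq ?enum_uniq //.
suff -> : (b \in take k (enum 'I_N)) = (b < k)%N by case: (_ < _)%N.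
rewrite -(mem_map val_inj) map_take val_enum_ord take_iota mem_iota /= add0n.
by rewrite leq_min ltn_ord andbT.
Qed.

Lemma sumn_content N (w : seq 'I_N) :
  sumn [seq count_mem a w | a : 'I_N <- enum 'I_N] = size w.
Proof.
rewrite -[X in sumn X]take_size sumn_take_count size_map -cardE card_ord.
by rewrite -count_predT; apply: eq_count => a /=; rewrite ltn_ord.
Qed.

Lemma luk_wordE N (w : seq 'I_N.+1) : size w = N ->
  luk_word w = [forall k : 'I_N.+1, (k <= count (fun a : 'I_N.+1 => (a < k)%N) w)%N].
Proof.
move=> sw; rewrite /luk_word lukE size_map -cardE card_ord.
rewrite sumn_content sw add1n eqxx andbT; apply/allP/forallP => [h k|h k].
  by have := h k; rewrite mem_iota sumn_take_count add1n ltnS; apply; rewrite /= ltn_ord.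
rewrite mem_iota => /andP[_ kN]; rewrite sumn_take_count add1n ltnS.
exact: (h (Ordinal kN)).
Qed.

Lemma luk_word_perm (A : comNzRingType) N :
  perm_invariant (fun w : seq 'I_N => (luk_word w)%:R : A).
Proof.
move=> v w /permP vw; rewrite /luk_word; congr (nat_of_bool (luk 1 _))%:R.
by apply: eq_map => a; apply: vw.
Qed.

Lemma luk_word_size N (w : seq 'I_N.+1) : luk_word w -> size w = N.
Proof.
rewrite /luk_word lukE sumn_content size_map -cardE card_ord add1n eqSS.
by case/andP => _ /eqP.
Qed.

(** The factor of [smirnov_weight] for consecutive letters b, c. *)
Definition tie_step (A : comNzRingType) (x : A) (b c : nat) : A :=
  if b == c then 0 else if (c < b)%N then x else 1.

Lemma smirnov_weightE (A : comNzRingType) (x : A) N k (t : k.-tuple 'I_N) :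
  smirnov_weight x t =
  \prod_(p : 'I_k * 'I_k | p.2 == p.1.+1 :> nat) tie_step x (tnth t p.1) (tnth t p.2).
Proof.
rewrite -(pair_big_dep xpredT (fun i j : 'I_k => j == i.+1 :> nat)
  (fun i j => tie_step x (tnth t i) (tnth t j))) /=.
elim: k t => [|k IH] t; first by rewrite big_ord0 tuple0.
case/tupleP: t => b v; rewrite big_ord_recl /= IH; congr (_ * _).
  rewrite big_mkcond big_ord_recl /= mul1r.
  case: k v {IH} => [|k] v; first by rewrite big_ord0 tuple0.
  case/tupleP: v => c v /=; rewrite big_ord_recl /= tnthS !tnth0 big1 ?mulr1 //.
apply: eq_bigr => i _; rewrite [RHS]big_mkcond big_ord_recl /= mul1r [LHS]big_mkcond.
by apply: eq_bigr => j _; rewrite !tnthS.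
Qed.

(** A function rho as a word over the alphabet with one more letter. *)
Definition widen_word (rho : {ffun 'I_n -> 'I_n}) : n.-tuple 'I_n.+1 :=
  [tuple widen_ord (leqnSn n) (rho i) | i < n].

Lemma luk_widen_word rho : luk_word (widen_word rho) = parking rho.
Proof.
rewrite luk_wordE ?size_tuple //; apply: eq_forallb => k; congr (_ <= _)%N.
rewrite -sum1_count big_map big_enum_cond -sum1_card; apply: eq_bigl => i.
by rewrite inE.
Qed.

Lemma smirnov_widen_word (A : comNzRingType) (x : A) rho :
  smirnov_weight x (widen_word rho) = if tieless rho then x ^+ des rho else 0.
Proof.
rewrite smirnov_weightE.
under eq_bigr do rewrite !tnth_mktuple /=.
case: ifP => [/forallP h|].
  rewrite /des -prodr_const big_mkcond [RHS]big_mkcond; apply: eq_bigr => -[i j] _ /=.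
  rewrite inE /=; case: ifP => //= ji; rewrite /tie_step.
  have /forallP/(_ j) := h i; rewrite ji /= => /negPf ij.
  by rewrite (inj_eq val_inj) ij.
move/negbT/forallPn => [i /forallPn[j]]; rewrite negb_imply negbK => /andP[ji /eqP e].
by rewrite (bigD1 (i, j)) //= e /tie_step eqxx mul0r.
Qed.

Lemma smirnov_sum_parking (A : comNzRingType) (x : A) : (0 < n)%N ->
  smirnov_sum x n (fun w : seq 'I_n.+1 => (luk_word w)%:R) =
  \sum_(rho in tieless_parking n) x ^+ des rho.
Proof.
move=> n0; rewrite /smirnov_sum word_sum_tuple.
transitivity (\sum_(t : n.-tuple 'I_n.+1 | luk_word t) smirnov_weight x t).
  rewrite [RHS]big_mkcond; apply: eq_bigr => t _.
  by case: ifP; rewrite ?mulr1 ?mulr0.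
pose h' (t : n.-tuple 'I_n.+1) : {ffun 'I_n -> 'I_n} :=
  [ffun i => insubd (Ordinal n0) (val (tnth t i))].
rewrite (reindex_onto widen_word h') /=; last first.
  move=> t; rewrite luk_wordE ?size_tuple // => /forallP/(_ ord_max) /= h.
  apply: eq_from_tnth => i; rewrite tnth_mktuple; apply: val_inj.
  rewrite /= ffunE val_insubd ifT //.
  have /allP : all (fun a : 'I_n.+1 => (a < n)%N) t.
    by rewrite all_count size_tuple eqn_leq h andbT (leq_trans (count_size _ _)) ?size_tuple.
  by apply; apply: mem_tnth.
rewrite [RHS]big_mkcond [LHS]big_mkcond; apply: eq_bigr => rho _.
have -> : h' (widen_word rho) = rho.
  apply/ffunP => i; rewrite ffunE tnth_mktuple; apply: val_inj.
  by rewrite val_insubd /= ltn_ord.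
rewrite eqxx andbT luk_widen_word inE smirnov_widen_word.
by case: parking; case: tieless.
Qed.

End Parking.

(** * The Chow polynomial *)

Section Chow.
Context (R : realType) (n : nat).
Local Notation P := (NC R n.+1).

(** The factor of the Chow polynomial for a rank jump k; it vanishes for k = 0,
    so that multichains may replace chains. *)
Definition chow_weight (k : nat) : {poly R} := 'X * qint R (k - 1).

Lemma sub1X_neq0 : (1 - 'X : {poly R}) != 0.
Proof. by rewrite -oppr_eq0 opprB -size_poly_eq0 size_XsubC. Qed.

Lemma chow_weightE k :
  (1 - 'X) * chow_weight k = 'X - 'X ^+ k + (1 - 'X) * 0 ^+ k.
Proof.
rewrite /chow_weight /qint; case: k => [|k].
  by rewrite big_ord0 !expr0; ring.
by rewrite subn1 /= exprS mulrCA -opprB mulNr -subrX1 expr0n /=; ring.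
Qed.

(** Multichains with a repetition contribute 0, because of the rank jump 0. *)
Lemma chain_sum m :
  \sum_(t : m.-tuple P | path <%O \bot%O t)
    \prod_(i < m) chow_weight (nc_rank (tnth t i) - nc_rank (nth \bot%O (\bot%O :: t) i)) =
  \sum_(d : dist_matrix m.+1 n.+1 | nc_ultrametricb d)
    \prod_(i < m) chow_weight #|[set a | exit_level d a == i.+1]|.
Proof.
transitivity (\sum_(t : m.-tuple P | path <=%O \bot%O t)
    \prod_(i < m) chow_weight (nc_rank (tnth t i) - nc_rank (nth \bot%O (\bot%O :: t) i))).
  rewrite [RHS](bigID (fun t : m.-tuple P => path <%O \bot%O t)) /= [X in _ = _ + X]big1 => [|t].
    rewrite addr0; apply: eq_bigl => t; case: (boolP (path <%O _ _)); rewrite ?andbF // andbT.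
    by move/(sub_path (@ltW _ P)) => ->.
  case/andP => le_t /(pathP (\bot%O : P)) lt_t.
  have [i hi] : exists i : 'I_m, ~~ (nth \bot%O (\bot%O :: t) i < tnth t i)%O.
    apply/existsP; rewrite -negb_forall; apply/negP => /forallP h; apply: lt_t => i.
    rewrite size_tuple => im; have := h (Ordinal im).
    by rewrite (tnth_nth \bot%O).
  rewrite (bigD1 i) //= [X in X * _](_ : _ = 0) ?mul0r //.
  have le_i : (nth \bot%O (\bot%O :: t) i <= tnth t i)%O.
    have /(pathP (\bot%O : P))/(_ i) := le_t.
    by rewrite size_tuple (tnth_nth \bot%O); apply.
  move: hi; rewrite lt_neqAle le_i andbT negbK => /eqP ->.
  by rewrite subnn /chow_weight /qint big_ord0 mulr0.
rewrite big_multichain; apply: eq_bigr => d /nc_ultrametricP nd.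
by apply: eq_bigr => i _; rewrite rank_jump.
Qed.

Lemma chain_block_sum m :
  \sum_(t : m.-tuple P | path <%O \bot%O t)
    \prod_(i < m) chow_weight (nc_rank (tnth t i) - nc_rank (nth \bot%O (\bot%O :: t) i)) =
  block_sum (nseq m chow_weight ++ [:: fun=> 1])
    (fun w : seq 'I_n.+1 => (luk_word w)%:R).
Proof.
have sz : size (nseq m chow_weight ++ [:: fun=> 1]) = m.+1.
  by rewrite size_cat size_nseq addn1.
rewrite chain_sum (block_sum_tuple _ sz).
transitivity (\sum_(d : dist_matrix m.+1 n.+1 | nc_ultrametricb d) 1 *
    \prod_(i < m) chow_weight #|[set a | exit_level d a == i.+1]|).
  by apply: eq_bigr => d _; rewrite mul1r.
rewrite (polarization sub1X_neq0 chow_weightE (Q' := xpredT)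
  (v' := fun S : m.+1.-tuple {set 'I_n.+1} =>
     (luk_word (flatten [seq enum (B : {set 'I_n.+1}) | B : {set 'I_n.+1} <- S]))%:R)
  (s' := fun S i => #|tnth S (widen_ord (leqnSn m) i)|)); last first.
  move=> y; rewrite -ultrametric_count; apply: eq_bigr => d _; exact: mul1r.
apply: eq_bigr => S _; rewrite mulrC big_ord_recr /= nth_cat size_nseq ltnn subnn mulr1.
congr (_ * _); apply: eq_bigr => i _.
by rewrite nth_cat size_nseq ltn_ord nth_nseq ltn_ord.
Qed.

End Chow.

Theorem theorem1p1 (R : realType) (n : nat) (hn : (1 <= n)%N) :
  chow_poly R (@nc_rank R n.+1)
    = \sum_(rho in tieless_parking n) 'X^(des rho) :> {poly R}.
Proof.
have w0 : chow_weight R 0 = 0 by rewrite /chow_weight /qint big_ord0 mulr0.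
have wS k : (1 - 'X) * chow_weight R k.+1 = 'X - 'X ^+ k.+1.
  by rewrite chow_weightE expr0n mulr0 addr0.
rewrite -smirnov_sum_parking //.
(* A chain from the minimum has fewer than #|NC_(n+1)| steps, so the summation
   over m may run further on, beyond n as needed. *)
rewrite (smirnov_sum_blocks (sub1X_neq0 R) w0 wS (M := #|{: NC R n.+1}| + n.+1)).
- rewrite /chow_poly big_split_ord /= [X in _ = _ + X]big1 ?addr0 => [|i _].
    by apply: eq_bigr => m _; rewrite -chain_block_sum.
  rewrite -chain_block_sum big_pred0 // => t.
  apply/negP => ct.
  have : uniq ((\bot%O : NC R n.+1) :: t).
    by apply: (@sorted_uniq _ <%O lt_trans ltxx); exact: ct.
  move=> /card_uniqP /= e; have := max_card (mem ((\bot%O : NC R n.+1) :: t)).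
  by rewrite e size_tuple ltnNge leq_addr.
- exact: luk_word_perm.
- move=> v; case: (boolP (luk_word v)) => // /luk_word_size -> /eqP //.
- by rewrite leq_addl.
Qed.
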